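(* Let $C$ be a convex disc in the plane. The dual Hadwiger number is $I(C)=6$ if $C$ is not a parallelogram and $I(C)=4$ if $C$ is a parallelogram. The dual strict Hadwiger number is $I'(C)=7$ if $C$ is not a parallelogram and $I'(C)=8$ if $C$ is a parallelogram.
   Context: A convex disc is a convex body (compact convex set with non-empty interior) in $\mathbb{R}^2$. Two convex bodies touch if they intersect but have disjoint interiors; they overlap if their interiors intersect. A collection $\{x_i+C : i\in I\}$ of translates of $C$ that all touch $C$ has a natural cyclic ordering, given by the cyclic ordering around the origin $o$ of the translation vectors $x_i$ (which lie on the boundary of a centrally symmetric convex disc homothetic to $\frac12(C-C)$). A dual Hadwiger family of $C$ is a collection of translates $C+x_i$ of $C$, all touching $C$, such that any two consecutive (in the natural cyclic ordering) translates are not disjoint (they touch or overlap), and such that $o$ is in the convex hull of the translation vectors $x_i$. A dual strict Hadwiger family of $C$ is a collection of translates of $C$, all touching $C$, such that any two consecutive translates overlap, and such that $o$ is in the convex hull of the translation vectors. $I(C)$ is the minimum size of a dual Hadwiger family of $C$, and $I'(C)$ is the minimum size of a dual strict Hadwiger family of $C$. Equivalently, in the norm with unit ball $B=\frac12(C-C)$, $I(C)$ [respectively $I'(C)$] is the smallest number of points on $\partial B$ containing $o$ in their convex hull such that cyclically consecutive points are at distance $\leq 1$ [respectively $<1$]. *)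

(* Defs.v *)
From HB Require Import structures.
From mathcomp Require Export all_boot all_order all_algebra.
From mathcomp Require Export all_classical all_reals all_analysis.
Export numFieldNormedType.Exports.

Set Implicit Arguments.
Unset Strict Implicit.
Unset Printing Implicit Defensive.

Import Order.TTheory GRing.Theory Num.Theory.

Local Open Scope classical_set_scope.
Local Open Scope ring_scope.

Definition convex_hull (R : realType) (X : set 'rV[R]_2) : set 'rV[R]_2 :=
  smallest (@convex_set R 'rV[R]_2) X.

Definition convex_disc (R : realType) (C : set 'rV[R]_2) : Prop :=
  [/\ compact C, @convex_set R 'rV[R]_2 C & interior C !=set0].

Definition parallelogram (R : realType) (C : set 'rV[R]_2) : Prop :=
  exists a u v : 'rV[R]_2, row_free (col_mx u v) /\
    C = [set a + s *: u + t *: v | s in `[0, 1] & t in `[0, 1]].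

Definition translate (R : realType) (C : set 'rV[R]_2) (x : 'rV[R]_2) :
  set 'rV[R]_2 := [set c + x | c in C].

Definition overlap (R : realType) (A B : set 'rV[R]_2) : Prop :=
  interior A `&` interior B !=set0.

Definition touch (R : realType) (A B : set 'rV[R]_2) : Prop :=
  A `&` B !=set0 /\ ~ overlap A B.

Definition direction (R : realType) (t : R) : 'rV[R]_2 :=
  \row_(j < 2) (if j == 0 then cos t else sin t).

(* [x] lists pairwise distinct directions counterclockwise, within one turn
   around the origin; [x (ordS i)] then follows [x i] in the cyclic order, the
   last vector being followed by the first. The initial vector is arbitrary. *)
Definition cyclically_ordered (R : realType) (n : nat)
    (x : 'I_n -> 'rV[R]_2) : Prop :=
  exists r t : 'I_n -> R,
    [/\ forall i, 0 < r i,
        forall i, x i = r i *: direction (t i),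
        forall i j : 'I_n, (i < j)%N -> t i < t j
      & forall i j : 'I_n, t j < t i + 2 * pi].

(* A finite collection of translates of [C] is given by its translation vectors,
   enumerated in their cyclic order. Vectors on a common ray from the origin are
   excluded, with no loss: if [C + x] and [C + s *: x] both touch the convex
   disc [C] and [s > 0], then [s = 1]. *)
Definition dual_hadwiger_family (R : realType) (C : set 'rV[R]_2) (n : nat)
    (x : 'I_n -> 'rV[R]_2) : Prop :=
  [/\ cyclically_ordered x,
      forall i, touch (translate C (x i)) C,
      forall i, translate C (x i) `&` translate C (x (ordS i)) !=set0
    & convex_hull (range x) 0].

Definition dual_strict_hadwiger_family (R : realType) (C : set 'rV[R]_2)
    (n : nat) (x : 'I_n -> 'rV[R]_2) : Prop :=
  [/\ cyclically_ordered x,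
      forall i, touch (translate C (x i)) C,
      forall i, overlap (translate C (x i)) (translate C (x (ordS i)))
    & convex_hull (range x) 0].

(* The least element of [S], or the junk value 0 when [S] is empty. The sets of
   sizes below never contain 0, since the convex hull of [set0] is [set0]. *)
Definition min_nat (S : set nat) : nat := xget 0%N (S `&` lbound S).

Definition dual_hadwiger_number (R : realType) (C : set 'rV[R]_2) : nat :=
  min_nat [set n | exists x : 'I_n -> 'rV[R]_2, dual_hadwiger_family C x].

Definition dual_strict_hadwiger_number (R : realType) (C : set 'rV[R]_2) :
    nat :=
  min_nat
    [set n | exists x : 'I_n -> 'rV[R]_2, dual_strict_hadwiger_family C x].

(* Main.v *)
Require Import Defs.
From mathcomp Require Import all_boot all_order all_algebra.
From mathcomp Require Import all_classical all_reals all_analysis.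
From mathcomp Require Import ring lra.

Set Implicit Arguments.
Unset Strict Implicit.
Unset Printing Implicit Defensive.

Import Order.TTheory GRing.Theory Num.Theory.

Local Open Scope classical_set_scope.
Local Open Scope ring_scope.

(* Let N be the gauge norm of D = C - C. The translate C + x touches C iff
   N x = 1, and two translates C + x and C + y meet (overlap) iff N (x - y) is at
   most 1 (less than 1).

   Lower bounds. If unit vectors p, h, k, q occur in this order within an angle
   less than pi and N (k - h) = 1, then N (q - p) >= 1. Hence a family with steps
   less than 1 cannot turn faster than a closed chain of unit vectors with steps
   equal to 1: the hexagon u, v, v - u, -u, -v, u - v through its first member
   gives at least 7 vectors, and for a parallelogram the octagon of vertices and
   midpoints gives at least 8. If q lies strictly beyond k and N (q - p) = 1, the
   unit circle contains a segment longer than 1 parallel to h or k. So a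
   hexagon without such segments parallel to its vertices gives at least 6 vectors
   when the steps are at most 1; and moving its vertices slightly backwards makes
   the steps less than 1, at the cost of one additional vector.

   Such a hexagon exists unless D is a parallelogram. Given a maximal segment of
   direction d and length L > 1 on the circle, L = 2 makes D a parallelogram. If
   L < 2, choose u on the segment at distance less than 1 from both ends: then
   u + d and u - d are outside D, and no segment longer than 1 is parallel to v or
   v - u, as its line would support D at u or -u, forcing v or v - u to be d or
   -d. The same segment cannot contain two such vectors u which are both parallel
   to segments longer than 1. *)

(** * Norms on the plane *)

Ltac vec := apply/rowP => ?; rewrite !mxE; ring.

Section Det2.
Variable R : realType.
Implicit Types x y z : 'rV[R]_2.

Definition det2 x y : R := x 0 0 * y 0 1 - x 0 1 * y 0 0.

Lemma det2C x y : det2 x y = - det2 y x.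
Proof. by rewrite /det2; ring. Qed.

Lemma det2xx x : det2 x x = 0.
Proof. by rewrite /det2; ring. Qed.

Lemma det2Dl x y z : det2 (x + y) z = det2 x z + det2 y z.
Proof. by rewrite /det2 !mxE; ring. Qed.

Lemma det2Dr x y z : det2 x (y + z) = det2 x y + det2 x z.
Proof. by rewrite /det2 !mxE; ring. Qed.

Lemma det2Zl a x y : det2 (a *: x) y = a * det2 x y.
Proof. by rewrite /det2 !mxE; ring. Qed.

Lemma det2Zr a x y : det2 x (a *: y) = a * det2 x y.
Proof. by rewrite /det2 !mxE; ring. Qed.

Lemma det2Nl x y : det2 (- x) y = - det2 x y.
Proof. by rewrite /det2 !mxE; ring. Qed.

Lemma det2Nr x y : det2 x (- y) = - det2 x y.
Proof. by rewrite /det2 !mxE; ring. Qed.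

Definition det2E := (det2Dl, det2Dr, det2Zl, det2Zr, det2Nl, det2Nr, det2xx).

Lemma rV2P x y : x 0 0 = y 0 0 -> x 0 1 = y 0 1 -> x = y.
Proof.
move=> e0 e1; apply/rowP => -[[|[|//]] i].
- by rewrite (_ : Ordinal i = 0) //; apply/val_inj.
- by rewrite (_ : Ordinal i = 1) //; apply/val_inj.
Qed.

Lemma cramer x y z : det2 x y != 0 ->
  z = (det2 z y / det2 x y) *: x + (det2 x z / det2 x y) *: y.
Proof.
by rewrite /det2 => d; apply: rV2P; rewrite !mxE; field.
Qed.

Lemma det2_eq0 x y : x != 0 -> det2 x y = 0 -> exists a, y = a *: x.
Proof.
move=> x0 d; case: (eqVneq (x 0 0) 0) => [e|n0].
  have n1 : x 0 1 != 0.
    apply: contra_neq x0 => e1; apply: rV2P; rewrite ?e ?e1 !mxE //.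
  exists (y 0 1 / x 0 1); apply: rV2P; rewrite !mxE ?divfK // e mulr0.
  move: d; rewrite /det2 e mul0r sub0r => /eqP.
  by rewrite oppr_eq0 mulf_eq0 (negPf n1) /= => /eqP.
exists (y 0 0 / x 0 0); apply: rV2P; rewrite !mxE ?divfK //.
move: d; rewrite /det2 => /eqP; rewrite subr_eq0 => /eqP d.
by apply: (mulfI n0); rewrite d; field.
Qed.

End Det2.

Section Norm.
Variable R : realType.
Notation V := 'rV[R]_2.

Definition is_norm (N : V -> R) :=
  [/\ forall x y, N (x + y) <= N x + N y,
      forall a x, N (a *: x) = `|a| * N x
    & forall x, N x = 0 -> x = 0].

(* By convexity, the whole segment from [q] to [q + c *: d] then lies on the unit
   circle. *)
Definition long (N : V -> R) (d : V) := exists q c e,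
  [/\ 1 < c, 0 < e < c, N q <= 1, N (q + c *: d) <= 1 & 1 <= N (q + e *: d)].

Variable N : V -> R.
Hypothesis nN : is_norm N.
Implicit Types x y z d h k p q u v w : V.

Lemma normD x y : N (x + y) <= N x + N y. Proof. by case: nN. Qed.
Lemma normZ a x : N (a *: x) = `|a| * N x. Proof. by case: nN. Qed.
Lemma norm_eq0 x : N x = 0 -> x = 0. Proof. by case: nN => _ _; apply. Qed.

Lemma norm0 : N 0 = 0.
Proof. by rewrite -(scale0r 0) normZ normr0 mul0r. Qed.

Lemma normN x : N (- x) = N x.
Proof. by rewrite -scaleN1r normZ normrN1 mul1r. Qed.

Lemma normB x y : N (x - y) = N (y - x).
Proof. by rewrite -normN opprB. Qed.

Lemma norm_ge0 x : 0 <= N x.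
Proof. by have := normD x (- x); rewrite subrr norm0 normN; lra. Qed.

Lemma norm1_neq0 x : N x = 1 -> x != 0.
Proof. by move=> x1; apply/eqP => x0; move: x1; rewrite x0 norm0; lra. Qed.

Lemma norm_le2 a b x y z : 0 <= a -> 0 <= b -> z = a *: x + b *: y ->
  N z <= a * N x + b * N y.
Proof.
move=> a0 b0 ->; apply: (le_trans (normD _ _)).
by rewrite !normZ !ger0_norm.
Qed.

Lemma norm_gt0 x : x != 0 -> 0 < N x.
Proof.
move=> x0; rewrite lt_neqAle norm_ge0 andbT eq_sym.
by apply: contra_neq x0 => /norm_eq0.
Qed.

Lemma norm_unit_eq0 u v : N u = 1 -> N v = 1 -> det2 u v = 0 -> v = u \/ v = - u.
Proof.
move=> u1 v1 /(det2_eq0 (norm1_neq0 u1)) [a va]; move: v1.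
rewrite va normZ u1 mulr1 => /eqP; rewrite eqr_norml => /andP[/orP[]/eqP-> _].
- by left; rewrite scale1r.
- by right; rewrite scaleN1r.
Qed.

(** Dependent unit vectors are equal or opposite, hence at distance 0 or 2. *)
Lemma det2_neq0 u v : N u = 1 -> N v = 1 -> N (v - u) = 1 -> det2 u v != 0.
Proof.
move=> u1 v1 d1; apply/eqP => /(norm_unit_eq0 u1 v1) [] e; move: d1; rewrite e.
- by rewrite subrr norm0; lra.
- rewrite (_ : - u - u = (- 2) *: u); last by vec.
  by rewrite normZ u1 mulr1 ler0_norm; lra.
Qed.

Section Triangle.
Variables h k : V.
Hypotheses (h1 : N h = 1) (k1 : N k = 1) (hk1 : N (k - h) = 1).

(** The vectors [h], [- k] and [h - k] all have norm 1. Splitting off the smaller coefficient times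
    [h - k] leaves a multiple of [h] or of [- k], and the two coefficients add up to the maximum. *)
Lemma norm_sub_le_max (a b : R) : 0 <= a -> 0 <= b ->
  N (a *: h - b *: k) <= Num.max a b.
Proof.
move=> a0 b0; rewrite le_max; case: (leP b a) => ab; apply/orP; [left|right].
- have E : a *: h - b *: k = (a - b) *: h + b *: (h - k) by vec.
  have := norm_le2 _ b0 E; rewrite h1 normB hk1; lra.
- have E : a *: h - b *: k = (b - a) *: (- k) + a *: (h - k) by vec.
  have := norm_le2 _ a0 E; rewrite normN k1 normB hk1; lra.
Qed.

(** Completing the vector to the larger coefficient times [k - h] costs at most the difference of
    the coefficients. *)
Lemma norm_sub_ge (a b : R) : 0 <= a -> 0 <= b ->
  Num.min a b <= N (b *: k - a *: h).
Proof.
move=> a0 b0; rewrite ge_min; case: (leP a b) => ab; apply/orP; [left|right].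
- have E : b *: (k - h) = 1 *: (b *: k - a *: h) + (b - a) *: (- h) by vec.
  have := norm_le2 ler01 _ E; rewrite normN h1 normZ hk1 ger0_norm //; lra.
- have E : a *: (k - h) = 1 *: (b *: k - a *: h) + (a - b) *: k by vec.
  have := norm_le2 ler01 _ E; rewrite k1 normZ hk1 ger0_norm //; lra.
Qed.

Lemma norm_sub_ge_l (a b : R) : 0 <= a -> 0 <= b -> a - b <= N (b *: k - a *: h).
Proof.
move=> a0 b0.
have E : a *: h = b *: k + 1 *: (- (b *: k - a *: h)) by vec.
have := norm_le2 b0 ler01 E; rewrite normN normZ h1 k1 ger0_norm //; lra.
Qed.

Lemma norm_sub_ge_r (a b : R) : 0 <= a -> 0 <= b -> b - a <= N (b *: k - a *: h).
Proof.
move=> a0 b0.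
have E : b *: k = a *: h + 1 *: (b *: k - a *: h) by vec.
have := norm_le2 a0 ler01 E; rewrite normZ h1 k1 ger0_norm //; lra.
Qed.

Lemma quadrilateral_bounds p q (a b c d : R) :
  0 <= a -> 0 <= b -> 0 <= c -> 0 <= d -> N p = 1 -> N q = 1 ->
  p = a *: h - b *: k -> q = d *: k - c *: h ->
  [/\ q - p = (d + b) *: k - (c + a) *: h, 1 <= a \/ 1 <= b, 1 <= c \/ 1 <= d,
      c + a <= N (q - p) \/ d + b <= N (q - p)
    & (c + a) - (d + b) <= N (q - p) /\ (d + b) - (c + a) <= N (q - p)].
Proof.
move=> a0 b0 c0 d0 p1 q1 pE qE.
have qpE : q - p = (d + b) *: k - (c + a) *: h by rewrite pE qE; vec.
split=> //.
- by apply/orP; have := norm_sub_le_max a0 b0; rewrite -pE p1 le_max.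
- by apply/orP; have := norm_sub_le_max c0 d0; rewrite normB -qE q1 le_max.
- apply/orP; rewrite -ge_min qpE.
  by apply: norm_sub_ge; rewrite addr_ge0.
- by rewrite qpE; split; [apply: norm_sub_ge_l|apply: norm_sub_ge_r];
    rewrite addr_ge0.
Qed.

(** Here [q - p] has coefficients [d + b] and [c + a] up to sign. Either both are at least 1, and
    their minimum bounds the norm, or one is at least 2, and the norm is at least the other one or
    the difference, hence at least 1. *)
Lemma quadrilateral_ge1 p q (a b c d : R) :
  0 <= a -> 0 <= b -> 0 <= c -> 0 <= d -> N p = 1 -> N q = 1 ->
  p = a *: h - b *: k -> q = d *: k - c *: h -> 1 <= N (q - p).
Proof.
move=> a0 b0 c0 d0 p1 q1 pE qE.
have [_ ab cd m [gl gr]] := quadrilateral_bounds a0 b0 c0 d0 p1 q1 pE qE.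
by case: ab => ab; case: cd => cd; case: m => m; lra.
Qed.

(** Equality case: the strict signs exclude [1 <= b] together with [1 <= c]. In the other cases
    [k - h] lies strictly between [q - p] and one of [k], [- h], on a line parallel to [h] or [k],
    and the segment is longer than 1. *)
Lemma quadrilateral_long p q (a b c d : R) :
  0 < a -> 0 <= b -> 0 < c -> 0 < d -> N p = 1 -> N q = 1 ->
  p = a *: h - b *: k -> q = d *: k - c *: h -> N (q - p) <= 1 ->
  long N h \/ long N k.
Proof.
move=> a0 b0 c0 d0 p1 q1 pE qE qp1.
have [qpE ab cd m []] :=
  quadrilateral_bounds (ltW a0) b0 (ltW c0) (ltW d0) p1 q1 pE qE.
move=> /le_trans /(_ qp1) gl /le_trans /(_ qp1) gr.
have {}m : c + a <= 1 \/ d + b <= 1.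
  by case: m => m; [left|right]; apply: le_trans qp1.
case: ab => ab; case: cd => cd.
- have aE : a = 1 by case: m; lra.
  have cE : c = 1 by case: m; lra.
  have dE : d + b = 1 by case: m; lra.
  left; exists (k - 2 *: h), 2, 1; split; [lra|lra| | |].
  + by rewrite (_ : _ - _ = q - p) // qpE aE cE dE; vec.
  + by rewrite subrK k1.
  + by rewrite (_ : _ + _ = k - h) ?hk1 //; vec.
- have dE : d = 1 by case: m; lra.
  have bE : b = 0 by case: m; lra.
  have aE : a = 1.
    by move: p1; rewrite pE bE scale0r subr0 normZ h1 mulr1 ger0_norm // ltW.
  left; exists (k - (1 + c) *: h), (1 + c), c; split; [lra|lra| | |].
  + by rewrite (_ : _ - _ = q - p) // qpE aE dE bE; vec.
  + by rewrite subrK k1.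
  + by rewrite (_ : _ + _ = k - h) ?hk1 //; vec.
- by case: m; lra.
- have dE : d = 1 by case: m; lra.
  have bE : b = 1 by case: m; lra.
  have aE : c + a = 1 by case: m; lra.
  right; exists (- h), 2, 1; split; [lra|lra| | |].
  + by rewrite normN h1.
  + by rewrite (_ : _ + _ = q - p) // qpE aE dE bE; vec.
  + by rewrite (_ : _ + _ = k - h) ?hk1 //; vec.
Qed.

(** Both coefficients are at most 1. If [b < 1], then [norm_sub_le_max] applies; if [b = 1], the
    points [k - h], [k] and [p] are collinear and span a segment of length [1 + a] parallel to
    [h]. *)
Lemma arc_lt1 (a b : R) p : 0 < a -> 0 < b -> p = a *: h + b *: k -> N p = 1 ->
  ~ long N h -> N (p - h) < 1.
Proof.
move=> a0 b0 pE p1 nl; rewrite ltNge; apply/negP => ph1; apply: nl.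
have b1 : b <= 1.
  have E : (a + b) *: k = 1 *: p + a *: (k - h) by rewrite pE; vec.
  by have := norm_le2 ler01 (ltW a0) E; rewrite normZ ger0_norm ?k1 ?hk1 ?p1; lra.
have a1 : a <= 1.
  have E : (a + b) *: h = 1 *: p + b *: (h - k) by rewrite pE; vec.
  have := norm_le2 ler01 (ltW b0) E.
  by rewrite normZ ger0_norm ?h1 ?(normB h) ?hk1 ?p1; lra.
have [b_lt1|b_ge1] := ltP b 1.
  have E : p - h = - ((1 - a) *: h - b *: k) by rewrite pE; vec.
  have : N (p - h) <= Num.max (1 - a) b.
    by rewrite E normN; apply: norm_sub_le_max; lra.
  by rewrite le_max => /orP[]; lra.
have bE : b = 1 by lra.
exists (k - h), (1 + a), 1; split; [lra|lra|by rewrite hk1| |].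
- by rewrite (_ : _ + _ = p) ?p1 // pE bE; vec.
- by rewrite (_ : _ + _ = k) ?k1 //; vec.
Qed.

Lemma arc_near (e : R) : 0 < e -> ~ long N h -> exists p (a b : R),
  [/\ 0 < a, 0 < b, p = a *: h + b *: k, N p = 1 & N (p - k) < e /\ N (p - h) < 1].
Proof.
(* The vector [k + d h] is normalised by a factor [m]. As [d <= 1 / 3], this factor is less than 2,
   so the result is within [2 m d < 4 d < e] of [k]. *)
move=> e0 nl; pose d := Num.min (e / 6) (1 / 3).
have d0 : 0 < d by rewrite lt_min; apply/andP; split; lra.
have de : d <= e / 6 by rewrite ge_min lexx.
have d3 : d <= 1 / 3 by rewrite ge_min lexx orbT.
pose g := k + d *: h.
have gE : g = 1 *: k + d *: h by rewrite /g scale1r.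
have g_le : N g <= 1 + d.
  by have := norm_le2 ler01 (ltW d0) gE; rewrite h1 k1; lra.
have g_ge : 1 - d <= N g.
  have E : k = 1 *: g + d *: (- h) by rewrite /g; vec.
  by have := norm_le2 ler01 (ltW d0) E; rewrite normN h1 k1; lra.
have g0 : 0 < N g by lra.
pose m := (N g)^-1.
have m0 : 0 < m by rewrite invr_gt0.
have mg : m * N g = 1 by rewrite mulVf // gt_eqF.
have p1 : N (m *: g) = 1 by rewrite normZ ger0_norm // ltW.
have pE : m *: g = (m * d) *: h + m *: k by rewrite /g; vec.
have md : 0 < m * d by rewrite mulr_gt0.
exists (m *: g), (m * d), m; split=> //; split; last first.
  exact: (arc_lt1 md m0 pE p1 nl).
have E : m *: g - k = (m - 1) *: k + (m * d) *: h by rewrite pE; vec.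
have m1 : `|m - 1| <= m * d.
  rewrite -mg ler_norml; apply/andP; split; nra.
rewrite E; apply: (le_lt_trans (normD _ _)).
rewrite !normZ h1 k1 !mulr1 (ger0_norm (ltW md)).
have : m * d < 2 * d by rewrite ltr_pM2r //; nra.
by lra.
Qed.

End Triangle.
End Norm.

(** * Long segments on the unit circle *)

Section LongSegments.
Variable R : realType.
Notation V := 'rV[R]_2.
Variable N : V -> R.
Hypothesis nN : is_norm N.
Implicit Types x y d q u v w : V.

Lemma longN d : long N d -> long N (- d).
Proof.
move=> [q [c [e [c1 ec q1 qc1 qe1]]]].
exists (q + c *: d), c, (c - e); split=> //; first by lra.
- by rewrite (_ : _ + _ = q) //; vec.
- by rewrite (_ : _ + _ = q + e *: d) //; vec.
Qed.

(** A point of the ball beyond the line of the segment, shrunk onto that line, would have norm less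
    than 1. Then so would [q + e d], which lies between it and an end of the segment. *)
Let supportP d q (c e : R) y : 0 < e < c -> N q <= 1 -> N (q + c *: d) <= 1 ->
  1 <= N (q + e *: d) -> d != 0 -> 0 < det2 d q -> N y <= 1 ->
  det2 d y <= det2 d q.
Proof.
move=> ec q1 qc1 qe1 d0 dq y1; rewrite leNgt; apply/negP => qy.
have dy : 0 < det2 d y by lra.
pose t := det2 d q / det2 d y.
have t0 : 0 < t by rewrite divr_gt0.
have t1 : t < 1 by rewrite ltr_pdivrMr // mul1r.
have [m mE] : exists m, t *: y - q = m *: d.
  apply: det2_eq0 => //; rewrite !det2E /t; field; lra.
have qm : N (q + m *: d) <= t.
  by rewrite -mE addrC subrK normZ // ger0_norm; nra.
have [me|em] := leP m e.
- have E : (c - m) *: (q + e *: d)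
    = (c - e) *: (q + m *: d) + (e - m) *: (q + c *: d) by vec.
  have ce0 : 0 <= c - e by lra.
  have em0 : 0 <= e - m by lra.
  have := norm_le2 nN ce0 em0 E; rewrite normZ // ger0_norm; last by lra.
  by nra.
- have E : m *: (q + e *: d) = e *: (q + m *: d) + (m - e) *: q by vec.
  have e0 : 0 <= e by lra.
  have em0 : 0 <= m - e by lra.
  have := norm_le2 nN e0 em0 E; rewrite normZ // ger0_norm; last by lra.
  by nra.
Qed.

Lemma long_support d : N d = 1 -> long N d -> exists q (c : R),
  [/\ 1 < c, N q <= 1, N (q + c *: d) <= 1, 0 < det2 d q
    & forall y, N y <= 1 -> det2 d y <= det2 d q].
Proof.
move=> d1 [q [c [e [c1 ec q1 qc1 qe1]]]].
have d0 := norm1_neq0 nN d1.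
have [dq|dq|/eqP dq] := ltgtP (det2 d q) 0.
(* Reflection in the origin keeps the direction and moves the segment to the positive side. *)
- exists (- (q + c *: d)), c; split=> //.
  + by rewrite normN.
  + by rewrite (_ : _ + _ = - q) ?normN //; vec.
  + by rewrite !det2E; lra.
  + move=> y; apply: (supportP (e := c - e) (c := c)) => //.
    * by lra.
    * by rewrite normN.
    * by rewrite (_ : _ + _ = - q) ?normN //; vec.
    * by rewrite (_ : _ + _ = - (q + e *: d)) ?normN //; vec.
    * by rewrite !det2E; lra.
- by exists q, c; split=> // y; apply: (supportP ec).
(* On the line through the origin the ball is the segment from [- d] to [d], whose inner points have
   norm less than 1. *)
- exfalso; have [k qE] := det2_eq0 d0 (eqP dq).
  move: q1 qc1 qe1; rewrite qE -!scalerDl !normZ // d1 !mulr1 => k1 kc1.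
  apply/negP; rewrite -ltNge; move: k1 kc1; rewrite !ler_norml ltr_norml.
  by move=> /andP[? ?] /andP[? ?]; apply/andP; split; lra.
Qed.

(** Suppose [u] is at relative height [t < 1] below the long segment, and write [u = t q + a v]. In
    each range of [a], one of [u] and [u - v] is a combination of vectors of the ball with too small
    a sum of coefficients; the length [c > 1] enters when [a] exceeds [t c]. *)
Let long_heightP u v : N u = 1 -> N v = 1 -> N (u - v) = 1 -> long N v ->
  0 < det2 v u -> forall y, N y <= 1 -> det2 v y <= det2 v u.
Proof.
move=> u1 v1 uv1 lv vu y y1.
have [q [c [c1 q1 qc1 vq]]] := long_support v1 lv.
move=> /(_ y y1) /le_trans; apply; rewrite leNgt; apply/negP => uq.
pose t := det2 v u / det2 v q.
have t0 : 0 < t by rewrite divr_gt0.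
have t1 : t < 1 by rewrite ltr_pdivrMr // mul1r.
have [a aE] : exists a, u - t *: q = a *: v.
  apply: det2_eq0; first exact: norm1_neq0 v1.
  by rewrite !det2E /t; field; lra.
have uE : u = t *: q + a *: v by rewrite -aE addrC subrK.
have [a0|a0] := ltP a 0.
  have E : (1 - a) *: u = (- a) *: (u - v) + t *: q by rewrite uE; vec.
  have Na : 0 <= - a by lra.
  have := norm_le2 nN Na (ltW t0) E.
  by rewrite normZ // ger0_norm ?u1 ?uv1; nra.
have [a1|a1] := ltP 1 a.
  have E : a *: (u - v) = (a - 1) *: u + t *: q by rewrite uE; vec.
  have Na : 0 <= a - 1 by lra.
  have := norm_le2 nN Na (ltW t0) E.
  by rewrite normZ // ger0_norm ?u1 ?uv1; nra.
have [act|act] := leP a (t * c).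
  have E : c *: u = a *: (q + c *: v) + (c * t - a) *: q by rewrite uE; vec.
  have Na : 0 <= c * t - a by lra.
  have := norm_le2 nN a0 Na E.
  by rewrite normZ // ger0_norm ?u1; nra.
have E : u = t *: (q + c *: v) + (a - t * c) *: v by rewrite uE; vec.
have Na : 0 <= a - t * c by lra.
by have := norm_le2 nN (ltW t0) Na E; rewrite u1 v1; nra.
Qed.

(* The long segment parallel to [v] must lie on the line through [u] and
   [u - v] or its opposite, so this line supports the unit ball. *)
Lemma long_height u v : N u = 1 -> N v = 1 -> N (u - v) = 1 -> long N v ->
  forall y, N y <= 1 -> det2 v y <= `|det2 v u|.
Proof.
move=> u1 v1 uv1 lv y y1.
have [vu|vu|vu] := ltgtP (det2 v u) 0.
(* The vector [v - u] is also at distance 1 from [v], and its height over [v] is opposite to that of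
   [u]. *)
- have := @long_heightP (v - u) v.
  rewrite normB // uv1 (_ : v - u - v = - u); last by vec.
  rewrite normN // u1 !det2E ltr0_norm // sub0r oppr_gt0.
  by apply.
- by rewrite gtr0_norm //; exact: long_heightP.
- by have := det2_neq0 nN v1 u1 uv1; rewrite vu eqxx.
Qed.

(** At an inner point [u] of a segment of the circle, the only supporting line is that of the
    segment. By [long_height] the parallel to [x] through [u] supports the ball, so [x] is [d] or
    [- d], although [u - d] and [u + d] are outside. *)
Lemma not_long_neighbour u d x (e : R) : 0 < e ->
  N (u + e *: d) <= 1 -> N (u - e *: d) <= 1 -> 1 < N (u + d) -> 1 < N (u - d) ->
  N d = 1 -> N u = 1 -> N x = 1 -> N (u - x) = 1 -> ~ long N x.
Proof.
move=> e0 up um upd umd d1 u1 x1 ux1 lx.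
have H := long_height u1 x1 ux1 lx.
have Hp := H _ up; have Hm := H _ um.
have HNp := H (- (u + e *: d)); have HNm := H (- (u - e *: d)).
rewrite (normN nN) in HNp; rewrite (normN nN) in HNm.
have {}HNp := HNp up; have {}HNm := HNm um.
rewrite !det2E in HNp HNm Hp Hm.
have e_det : e * det2 x d = 0.
  have [xu|xu] := leP 0 (det2 x u).
  - by rewrite !(ger0_norm xu) in HNp HNm Hp Hm; lra.
  - by rewrite !(ltr0_norm xu) in HNp HNm Hp Hm; lra.
have det0 : det2 x d = 0.
  by move/eqP: e_det; rewrite mulf_eq0 gt_eqF //= => /eqP.
have [E|E] := norm_unit_eq0 nN x1 d1 det0.
- by move: umd; rewrite E ux1; lra.
- by move: upd; rewrite E ux1; lra.
Qed.

(** Heights over [d] are at most that of [u], so a segment in direction [u] longer than 1 must cross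
    the line of [d]. It also supports the ball, so it crosses at [d] or [- d]; by symmetry [d] is an
    inner point of a segment in direction [u]. *)
Lemma long_transversal d u : N d = 1 -> N u = 1 -> 0 < det2 d u ->
  (forall y, N y <= 1 -> det2 d y <= det2 d u) -> long N u ->
  exists e e' : R, [/\ 0 < e, 0 < e', N (d + e *: u) <= 1 & N (d - e' *: u) <= 1].
Proof.
move=> d1 u1 du Hd lu.
have [q [c [c1 q1 qc1 uq Hu]]] := long_support u1 lu.
have d0 : det2 d u != 0 by rewrite gt_eqF.
have qE := cramer q d0.
set A := det2 q u / _ in qE; set B := det2 d q / _ in qE.
have B1 : B + c <= 1.
  have := Hd _ qc1; rewrite qE !det2E mulr0 add0r -mulrDl.
  by rewrite -[leRHS]mul1r ler_pM2r.
have B_1 : -1 <= B.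
  have := Hd (- q); rewrite normN // => /(_ q1).
  rewrite qE !det2E mulr0 add0r -mulNr -[leRHS]mul1r ler_pM2r //; lra.
have A_1 : 1 <= - A.
  have := Hu (- d); rewrite normN // d1 lexx => /(_ isT).
  rewrite qE !det2E mulr0 addr0 (det2C u d) opprK mulrN -mulNr.
  by rewrite -[leLHS]mul1r ler_pM2r.
have A1 : - A <= 1.
  have E : (c * A) *: d = (- B) *: (q + c *: u) + (B + c) *: q.
    by rewrite {1 2}qE; vec.
  have B0 : 0 <= - B by lra.
  have Bc0 : 0 <= B + c by lra.
  have := norm_le2 nN B0 Bc0 E.
  rewrite normZ // d1 mulr1 ler0_norm; last by nra.
  by nra.
have AE : A = -1 by lra.
rewrite AE in qE.
exists (- B), (B + c); split; [lra|lra| |].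
- by rewrite (_ : _ + _ = - q) ?normN // qE; vec.
- by rewrite (_ : _ - _ = - (q + c *: u)) ?normN // qE; vec.
Qed.

Lemma segment_end d q : N d = 1 -> N q <= 1 -> exists a : R,
  [/\ 0 <= a, N (q + a *: d) <= 1 & forall s, N (q + s *: d) <= 1 -> s <= a].
Proof.
move=> d1 q1; pose S : set R := [set s | N (q + s *: d) <= 1].
have S0 : S 0 by rewrite /S /= scale0r addr0.
have Sub : ubound S 2.
  move=> s; rewrite /S /= => qs.
  have E : s *: d = 1 *: (q + s *: d) + 1 *: (- q) by vec.
  have := norm_le2 nN ler01 ler01 E; rewrite normZ // d1 normN //.
  by have := ler_norm s; lra.
have supS : has_sup S by split; [exists 0|exists 2].
exists (sup S); split; first exact: ub_le_sup supS.2 _ S0.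
(* Moving by [s] along [d] changes the norm by at most [|s|]. If the norm at the supremum exceeded 1
   by [h], no admissible parameter could be within [h] of it. *)
- rewrite leNgt; apply/negP => gt1.
  pose h := N (q + sup S *: d) - 1.
  have h0 : 0 < h by rewrite subr_gt0.
  have [s Ss ls] := sup_adherent h0 supS.
  have les : 0 <= sup S - s by rewrite subr_ge0; apply: ub_le_sup supS.2 _ Ss.
  have E : q + sup S *: d = 1 *: (q + s *: d) + (sup S - s) *: d by vec.
  have := norm_le2 nN ler01 les E; rewrite d1 -/h.
  move: Ss; rewrite /S /= => Ss; rewrite /h in ls; lra.
- by move=> s Ss; apply: ub_le_sup supS.2 _ Ss.
Qed.

End LongSegments.

(** * Inscribed hexagons *)

Lemma coord_le_norm (R : realType) (z : 'rV[R]_2) j : `|z 0 j| <= `|z|.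
Proof.
rewrite [leRHS]/Num.norm /= mx_normrE.
exact: (le_bigmax _ (fun i : 'I_1 * 'I_2 => `|z i.1 i.2|) (0, j)).
Qed.

Section Hexagon.
Variable R : realType.
Notation V := 'rV[R]_2.
Variable N : V -> R.
Hypothesis nN : is_norm N.
Implicit Types d q u v w : V.

Lemma norm_continuous : continuous N.
Proof.
pose e0 : V := delta_mx 0 0; pose e1 : V := delta_mx 0 1.
pose K := N e0 + N e1 + 1.
have K0 : 0 < K.
  by have := norm_ge0 nN e0; have := norm_ge0 nN e1; rewrite /K; lra.
have NK z : N z <= K * `|z|.
  have E : z = z 0 0 *: e0 + z 0 1 *: e1.
    by apply: rV2P; rewrite !mxE /= ?eqxx /=; ring.
  rewrite {1}E; apply: (le_trans (normD nN _ _)).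
  rewrite !normZ //.
  have z0 := coord_le_norm z 0; have z1 := coord_le_norm z 1.
  have := norm_ge0 nN e0; have := norm_ge0 nN e1; have := normr_ge0 z.
  by rewrite /K; nra.
move=> x; apply/(cvgrPdist_le (FF := nbhs_filter x)) => e e_gt0.
have eK : 0 < e / K by rewrite divr_gt0.
apply/nbhs_ballP; exists (e / K) => // y; rewrite -ball_normE /= => /ltW H.
have {}H : K * `|x - y| <= e by rewrite mulrC -ler_pdivlMr.
have xy := NK (x - y).
have := normD nN (x - y) y; have := normD nN (y - x) x.
rewrite !subrK (normB nN y) ler_norml => ? ?; apply/andP; split; lra.
Qed.

(** Along a half turn of the circle from [u] to [- u] the distance from [u] grows from 0 to 2; the
    intermediate value theorem finds distance 1. *)
Lemma exists_hexagon u : N u = 1 ->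
  exists v, [/\ N v = 1, N (v - u) = 1 & 0 < det2 u v].
Proof.
move=> u1.
have u0 := norm1_neq0 nN u1.
pose z : V := \row_(j < 2) (if j == 0 then - u 0 1 else u 0 0).
have uz : 0 < det2 u z.
  rewrite /det2 !mxE /= mulrN opprK -!expr2 lt_neqAle eq_sym.
  rewrite paddr_eq0 ?sqr_ge0 // !sqrf_eq0 addr_ge0 ?sqr_ge0 // andbT.
  apply: contra_neqN u0 => /andP[/eqP e0 /eqP e1].
  by apply: rV2P; rewrite ?e0 ?e1 !mxE.
(* The curve [g] runs from [u] to [- u] on the side of [z], which is [u] rotated by a quarter turn.
   A zero of [f] is a parameter at which [g s], once normalised, is at distance 1 from [u]; this
   form avoids division. *)
pose g (s : R) : V := (1 - 2 * s) *: u + (s * (1 - s)) *: z.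
pose f s := N (g s - N (g s) *: u) - N (g s).
have gc : continuous g.
  move=> s; apply: cvgD; apply: cvgZl.
  - apply: cvgB; first exact: cvg_cst.
    by apply: cvgM; [exact: cvg_cst|exact: cvg_id].
  - apply: cvgM; first exact: cvg_id.
    by apply: cvgB; [exact: cvg_cst|exact: cvg_id].
have Ngc : continuous (N \o g).
  by move=> s; apply: continuous_comp; [exact: gc|exact: norm_continuous].
have fc : continuous f.
  move=> s; apply: cvgB; last exact: Ngc.
  apply: (@continuous_comp _ _ _ (fun s => g s - N (g s) *: u) N).
    by apply: cvgB; [exact: gc|apply: cvgZl; exact: Ngc].
  exact: norm_continuous.
have f0 : f 0 = - 1.
  rewrite /f (_ : g 0 = u) ?u1 ?scale1r ?subrr ?(norm0 nN) ?sub0r //.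
  by rewrite /g; vec.
have f1 : f 1 = 1.
  rewrite /f (_ : g 1 = - u); last by rewrite /g; vec.
  rewrite (normN nN) u1 (_ : _ - _ = (-2) *: u); last by vec.
  by rewrite (normZ nN) u1 normrN ger0_norm; lra.
have [||s s01 fs] := @IVT R f 0 1 0 ler01.
- exact: continuous_subspaceT.
- by rewrite f0 f1 ge_min le_max; apply/andP; split; apply/orP; [left|right]; lra.
have [s0 s1] : 0 < s /\ s < 1.
  move: s01; rewrite in_itv /= => /andP[s_ge0 s_le1].
  rewrite !lt_neqAle s_ge0 s_le1 !andbT; split; apply/eqP => E.
  - by move: fs; rewrite -E f0; lra.
  - by move: fs; rewrite E f1; lra.
have ss : 0 < s * (1 - s) by nra.
have dg : 0 < det2 u (g s) by rewrite /g !det2E mulr0 add0r mulr_gt0.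
have gs0 : g s != 0.
  apply/eqP => gs; move: dg; rewrite gs /det2 !mxE; lra.
have Ng := norm_gt0 nN gs0.
pose m := (N (g s))^-1.
have m0 : 0 < m by rewrite invr_gt0.
exists (m *: g s); split.
- by rewrite normZ // ger0_norm ?ltW // mulVf // gt_eqF.
- rewrite (_ : _ - _ = m *: (g s - N (g s) *: u)); last first.
    by rewrite scalerBr scalerA mulVf ?gt_eqF // scale1r.
  rewrite normZ // (ger0_norm (ltW m0)).
  move/eqP: fs; rewrite subr_eq0 => /eqP ->.
  by rewrite mulVf // gt_eqF.
- by rewrite det2Zr mulr_gt0.
Qed.

(** This is the maximum norm in the coordinates along [d] and [m]; the sums and differences of [d],
    [m] and their opposites are the corners of the ball. *)
Definition parallelogram_norm d m :=
  forall a b : R, (N (a *: d + b *: m) <= 1) = (`|a| <= 1) && (`|b| <= 1).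

(** The other three vertices are the opposites of [u], [v], [v - u], and [long] is preserved by
    negation. *)
Definition good_hexagon u v := [/\ N u = 1, N v = 1, N (v - u) = 1,
  0 < det2 u v & [/\ ~ long N u, ~ long N v & ~ long N (v - u)]].

Lemma parallelogram_or_good_hexagon :
  (exists d m, 0 < det2 d m /\ parallelogram_norm d m) \/
  (exists u v, good_hexagon u v).
Proof.
have [[d [d1 ld]]|nl] := pselect (exists d, N d = 1 /\ long N d); last first.
  (* Without long directions every hexagon is good; [e0] only supplies a vector to normalise. *)
  right; pose e0 : V := delta_mx 0 0.
  have e0_neq0 : e0 != 0.
    apply/eqP => /rowP /(_ 0); rewrite !mxE /= => /eqP.
    by rewrite oner_eq0.
  have Ne0 := norm_gt0 nN e0_neq0.
  pose u := (N e0)^-1 *: e0.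
  have u1 : N u = 1.
    by rewrite normZ // ger0_norm ?invr_ge0 ?ltW // mulVf // gt_eqF.
  have [v [v1 vu1 uv]] := exists_hexagon u1.
  by exists u, v; split=> //; split=> l; apply: nl; [exists u|exists v|exists (v - u)].
have [q [c [c1 q1 qc1 dq Hq]]] := long_support nN d1 ld.
(* The segment is extended to a maximal one, from [q - b d] to [q + a d]. *)
have [a [a0 qa Ha]] := segment_end nN d1 q1.
have d1' : N (- d) = 1 by rewrite normN.
have [b [b0 qb Hb]] := segment_end nN d1' q1.
have ca : c <= a by exact: Ha.
have ab2 : a + b <= 2.
  have E : (a + b) *: d = 1 *: (q + a *: d) + 1 *: (- (q + b *: - d)) by vec.
  have := norm_le2 nN ler01 ler01 E.
  by rewrite normZ // d1 normN // ger0_norm; lra.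
have seg (s : R) : - b <= s -> s <= a -> N (q + s *: d) <= 1.
  move=> bs sa.
  have E : (a + b) *: (q + s *: d)
    = (s + b) *: (q + a *: d) + (a - s) *: (q + b *: - d) by vec.
  have sb0 : 0 <= s + b by lra.
  have as0 : 0 <= a - s by lra.
  have := norm_le2 nN sb0 as0 E; rewrite normZ // ger0_norm; last by lra.
  by nra.
have [ab|ab] := ltP (a + b) 2; last first.
  (* A segment of length 2 has ends [m - d] and [m + d], where [m] is its midpoint: it is a whole
     side of the ball. *)
  left; have [m [dm mp mm]] : exists m,
      [/\ det2 d m = det2 d q, N (m + d) <= 1 & N (m - d) <= 1].
    exists (q + (a - 1) *: d); split; first by rewrite !det2E mulr0 addr0.
    - by rewrite (_ : _ + d = q + a *: d) //; vec.
    - rewrite (_ : _ - d = q + b *: - d) //.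
      by rewrite (_ : b = 2 - a); [vec|lra].
  exists d, m; split; first by rewrite dm.
  have xle (x : R) : `|x| <= 1 -> N (m + x *: d) <= 1.
    rewrite ler_norml => /andP[x_1 x1].
    have E : m + x *: d = ((1 + x) / 2) *: (m + d) + ((1 - x) / 2) *: (m - d).
      by apply/rowP => i; rewrite !mxE; field.
    have x0 : 0 <= (1 + x) / 2 by lra.
    have x0' : 0 <= (1 - x) / 2 by lra.
    by have := norm_le2 nN x0 x0' E; nra.
  have lex x y : N (x *: d + y *: m) <= 1 -> x <= 1.
    move=> xy; have [y0|y0] := leP 0 y.
    - have E : (x + y) *: d = 1 *: (x *: d + y *: m) + y *: (- (m - d)) by vec.
      have := norm_le2 nN ler01 y0 E.
      rewrite normZ // d1 normN //.
      by have := ler_norm (x + y); nra.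
    - have y0' : 0 <= - y by lra.
      have E : (x - y) *: d = 1 *: (x *: d + y *: m) + (- y) *: (m + d) by vec.
      have := norm_le2 nN ler01 y0' E.
      rewrite normZ // d1.
      by have := ler_norm (x - y); nra.
  have ley x y : N (x *: d + y *: m) <= 1 -> y <= 1.
    by move=> /Hq; rewrite -dm !det2E mulr0 add0r ger_pMl // dm.
  have Nxy (x y : R) : N (x *: d + y *: m) = N ((- x) *: d + (- y) *: m).
    by rewrite -normN //; congr N; vec.
  move=> x y; apply/idP/idP => [xy|/andP[x_le1 y_le1]].
  - have xy' := xy; rewrite Nxy in xy'.
    rewrite !ler_norml (lex _ _ xy) (ley _ _ xy).
    by have := lex _ _ xy'; have := ley _ _ xy' => ? ?; apply/andP; split; lra.
  - have xm : N (- (m + (- x) *: d)) <= 1 by rewrite normN // xle // normrN.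
    have E : x *: d + y *: m =
        ((1 + y) / 2) *: (m + x *: d) + ((1 - y) / 2) *: (- (m + (- x) *: d)).
      by apply/rowP => i; rewrite !mxE; field.
    move: y_le1; rewrite ler_norml => /andP[? ?].
    have y0 : 0 <= (1 + y) / 2 by lra.
    have y0' : 0 <= (1 - y) / 2 by lra.
    by have := norm_le2 nN y0 y0' E; have := xle x x_le1; nra.
right.
have du s : det2 d (q + s *: d) = det2 d q by rewrite !det2E mulr0 addr0.
(* A point of the segment with norm less than 1 could be scaled up within the ball, past the
   supporting line. *)
have u_eq1 s : - b <= s -> s <= a -> N (q + s *: d) = 1.
  move=> bs sa; apply/eqP; rewrite eq_le seg //= leNgt; apply/negP => lt1.
  set u := q + _ in lt1.
  have u0 : u != 0.
    by apply/eqP => u0; move: dq; rewrite -(du s) -/u u0 /det2 !mxE; lra.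
  have Nu := norm_gt0 nN u0.
  have : det2 d ((N u)^-1 *: u) <= det2 d q.
    apply: Hq; rewrite (normZ nN) ger0_norm ?invr_ge0 ?norm_ge0 //.
    by rewrite mulVf // gt_eqF.
  rewrite det2Zr du -[leRHS]mul1r ler_pM2r // leNgt invf_gt1 //.
  by rewrite lt1.
(* The bounds on [s] say that [u] is at distance less than 1 from both ends, so that [u + d] and
   [u - d] pass beyond the maximal segment. *)
have good s : a - 1 < s -> s < 1 - b -> ~ long N (q + s *: d) ->
    exists u v, good_hexagon u v.
  move=> as1 sb1 nlu; set u := q + s *: d in nlu.
  have u1 : N u = 1 by apply: u_eq1; lra.
  have [v [v1 vu1 uv]] := exists_hexagon u1.
  have upd : 1 < N (u + d).
    rewrite ltNge; apply/negP => le1.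
    have := Ha (s + 1); rewrite (_ : _ + _ = u + d); last by rewrite /u; vec.
    by move=> /(_ le1); lra.
  have umd : 1 < N (u - d).
    rewrite ltNge; apply/negP => le1.
    have := Hb (1 - s); rewrite (_ : _ + _ = u - d); last by rewrite /u; vec.
    by move=> /(_ le1); lra.
  pose e := Num.min (a - s) (s + b).
  have e0 : 0 < e by rewrite lt_min; apply/andP; split; lra.
  have ea : e <= a - s by rewrite ge_min lexx.
  have eb : e <= s + b by rewrite ge_min lexx orbT.
  have up : N (u + e *: d) <= 1.
    rewrite (_ : u + _ = q + (s + e) *: d); last by rewrite /u; vec.
    by apply: seg; lra.
  have um : N (u - e *: d) <= 1.
    rewrite (_ : u - _ = q + (s - e) *: d); last by rewrite /u; vec.
    by apply: seg; lra.
  have NuBd z : N (- u + z) = N (u - z) by rewrite -normN // opprD opprK.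
  exists u, v; split=> //; split=> //.
  - by apply: (not_long_neighbour nN e0 up um) => //; rewrite (normB nN).
  (* The vertex [v - u] is at distance 1 from [- u], an inner point of the opposite segment. *)
  - apply: (@not_long_neighbour _ _ nN (- u) d _ e) => //.
    + by rewrite NuBd.
    + by rewrite NuBd opprK.
    + by rewrite NuBd.
    + by rewrite NuBd opprK.
    + by rewrite normN.
    + by rewrite (_ : _ - _ = - v) ?normN //; vec.
(* The admissible parameters form the interval from [a - 1] to [1 - b]; [s1] is its midpoint and
   [s2] lies three quarters of the way along. *)
pose s1 := (a - b) / 2; pose s2 := s1 + (2 - (a + b)) / 4.
have [l1|] := pselect (long N (q + s1 *: d)); last first.
  by apply: good; rewrite /s1; lra.
have [l2|] := pselect (long N (q + s2 *: d)); last first.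
  by apply: good; rewrite /s2 /s1; lra.
exfalso.
have N1 : N (q + s1 *: d) = 1 by apply: u_eq1; rewrite /s1; lra.
have N2 : N (q + s2 *: d) = 1 by apply: u_eq1; rewrite /s2 /s1; lra.
have T s := @long_transversal _ _ nN d (q + s *: d) d1.
have := T s1 N1; rewrite du => /(_ dq Hq l1) [_ [e' [_ e'0 _ m1]]].
have := T s2 N2; rewrite du => /(_ dq Hq l2) [e [_ [e0 _ p2 _]]].
have s12 : 0 < s2 - s1 by rewrite /s2; lra.
(* If both vectors were long, [d] would be inner to two segments of different directions. A convex
   combination of an end of each is a multiple of [d] by a factor above 1. *)
have E : (e + e' + e * e' * (s2 - s1)) *: d =
    e' *: (d + e *: (q + s2 *: d)) + e *: (d - e' *: (q + s1 *: d)) by vec.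
have := norm_le2 nN (ltW e'0) (ltW e0) E.
have p : 0 < e * e' * (s2 - s1) by rewrite !mulr_gt0.
by rewrite normZ // d1 mulr1 ger0_norm; nra.
Qed.

End Hexagon.

(** * Angles and chains of unit vectors *)

Section Angles.
Variable R : realType.
Notation V := 'rV[R]_2.
Implicit Types (p q u v : V) (a b s t : R).

(** Angles are not reduced modulo [2 pi], so that they can keep increasing along a path that turns
    around the origin. *)
Definition polar p t := exists2 r : R, 0 < r & p = r *: direction t.

Lemma det2_direction a b : det2 (direction a) (direction b) = sin (b - a).
Proof. by rewrite /det2 !mxE /= sinB; ring. Qed.

Lemma directionDpi t : direction (t + pi) = - direction t.
Proof. by apply: rV2P; rewrite !mxE /= ?cosDpi ?sinDpi. Qed.

Lemma polarN p t : polar p t -> polar (- p) (t + pi).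
Proof. by move=> [r r0 ->]; exists r => //; rewrite directionDpi scalerN. Qed.

Lemma polarD2pi p t : polar p t -> polar p (t + 2 * pi).
Proof. by move=> /polarN/polarN; rewrite opprK -addrA mulr_natl mulr2n. Qed.

Lemma polarB2pi p t n : polar p t -> polar p (t - n%:R * (2 * pi)).
Proof.
elim: n => [|n IHn] pt; first by rewrite mul0r subr0.
have [r r0 ->] := IHn pt; exists r => //; congr (_ *: _).
rewrite (_ : t - n%:R * _ = t - n.+1%:R * (2 * pi) + pi + pi).
  by rewrite !directionDpi opprK.
by rewrite -natr1; ring.
Qed.

Lemma polar_det2 p q a b : polar p a -> polar q b ->
  exists2 r : R, 0 < r & det2 p q = r * sin (b - a).
Proof.
move=> [r r0 ->] [r' r'0 ->]; exists (r * r'); first exact: mulr_gt0.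
by rewrite det2Zl det2Zr det2_direction mulrA.
Qed.

Lemma polar_det2_gt0 p q a b : polar p a -> polar q b -> a < b < a + pi ->
  0 < det2 p q.
Proof.
move=> pa qb ab; have [r r0 ->] := polar_det2 pa qb.
by rewrite mulr_gt0 // sin_gt0_pi //; apply/andP; split; lra.
Qed.

Lemma polar_det2_ge0 p q a b : polar p a -> polar q b -> a <= b <= a + pi ->
  0 <= det2 p q.
Proof.
move=> pa qb ab; have [r r0 ->] := polar_det2 pa qb.
by rewrite mulr_ge0 ?(ltW r0) // sin_ge0_pi //; apply/andP; split; lra.
Qed.

Lemma polar_lt p q a b : polar p a -> polar q b -> 0 < det2 p q ->
  a - b < pi -> a < b.
Proof.
move=> pa qb; have [r r0 ->] := polar_det2 pa qb.
rewrite pmulr_rgt0 // => s0 ab; rewrite ltNge; apply/negP => ba.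
have : 0 <= sin (a - b) by apply: sin_ge0_pi; apply/andP; split; lra.
by rewrite -opprB sinN; lra.
Qed.

Lemma polar_upper u v t : polar u t -> 0 < det2 u v ->
  exists2 f, 0 < f < pi & polar v (t + f).
Proof.
move=> [r0 r0_gt0 ->]; rewrite det2Zl pmulr_rgt0 // => uv.
(* The numbers [a] and [b] are the coordinates of [v] in the frame turned by [t]; since [b > 0], the
   arccosine gives the angle. *)
pose a := v 0 0 * cos t + v 0 1 * sin t.
set b := det2 _ _ in uv.
have bE : b = cos t * v 0 1 - sin t * v 0 0 by rewrite /b /det2 !mxE.
clearbody b.
have s2 : 0 < a ^+ 2 + b ^+ 2 by nra.
pose r := Num.sqrt (a ^+ 2 + b ^+ 2).
have r_gt0 : 0 < r by rewrite sqrtr_gt0.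
have rr : r ^+ 2 = a ^+ 2 + b ^+ 2 by rewrite sqr_sqrtr // ltW.
have ar : -1 < a / r < 1.
  by rewrite ltr_pdivlMr // ltr_pdivrMr // mulN1r mul1r; apply/andP; split; nra.
have [ar1 ar2] := andP ar.
have ar_le : -1 <= a / r <= 1 by rewrite (ltW ar1) (ltW ar2).
exists (acos (a / r)).
  by rewrite acos_gt0 ?acos_ltpi ?(ltW ar1) ?(ltW ar2) ?ar1 ?ar2.
have c_acos : cos (acos (a / r)) = a / r by rewrite acosK // in_itv.
have s_acos : sin (acos (a / r)) = b / r.
  rewrite sin_acos //.
  rewrite (_ : 1 - _ = (b / r) ^+ 2) ?sqrtr_sqr ?ger0_norm ?divr_ge0 ?(ltW uv) ?(ltW r_gt0) //.
  have rn0 : r != 0 by rewrite gt_eqF.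
  rewrite !exprMn !exprVn rr -(divff (lt0r_neq0 s2)).
  by field; rewrite gt_eqF.
have rn0 : r != 0 by rewrite gt_eqF.
have cs := cos2Dsin2 t.
exists r => //; apply: rV2P; rewrite !mxE /= ?cosD ?sinD c_acos s_acos.
- transitivity (cos t * a - sin t * b); last by field.
  by rewrite bE /a -[LHS]mul1r -cs; ring.
- transitivity (sin t * a + cos t * b); last by field.
  by rewrite bE /a -[LHS]mul1r -cs; ring.
Qed.

Lemma polar_exists v : v != 0 -> exists t, polar v t.
Proof.
move=> v0; pose e : V := direction 0.
have e0 : polar e 0 by exists 1; rewrite ?scale1r.
have [ev|ev|ev] := ltgtP (det2 e v) 0.
- have [||f _ vf] := @polar_upper e (- v) 0 => //; first by rewrite det2Nr oppr_gt0.
  by exists (0 + f + pi); rewrite -(opprK v); apply: polarN.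
- by have [f _ vf] := polar_upper e0 ev; exists (0 + f).
- have en0 : e != 0.
    apply/eqP => /rowP /(_ 0); rewrite !mxE /= cos0 => /eqP.
    by rewrite oner_eq0.
  have [c vE] := det2_eq0 en0 ev.
  have [c0|c0|c0] := ltgtP c 0.
  + exists (0 + pi); exists (- c); first by rewrite oppr_gt0.
    by rewrite directionDpi scalerN scaleNr opprK.
  + by exists 0, c.
  + by move: v0; rewrite vE c0 scale0r eqxx.
Qed.

Lemma polar_exists_lt v b : v != 0 -> exists2 t, polar v t & t < b.
Proof.
move=> /polar_exists [t vt].
pose n := Num.bound (`|t - b|); exists (t - n%:R * (2 * pi)).
  exact: polarB2pi.
have : `|t - b| < n%:R by apply: archi_boundP.
have := ler_norm (t - b); have := @pi_ge2 R => p tb bn.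
have : 0 <= n%:R :> R by [].
by nra.
Qed.

End Angles.

Section Chains.
Variable R : realType.
Notation V := 'rV[R]_2.
Variable N : V -> R.
Hypothesis nN : is_norm N.

Let decompose (h k p : V) : 0 < det2 h k ->
  p = (det2 p k / det2 h k) *: h - (det2 p h / det2 h k) *: k.
Proof.
move=> hk; rewrite {1}(cramer p (lt0r_neq0 hk)) (det2C h p).
by rewrite mulNr scaleNr.
Qed.

Section Step.
Variables (h k p q : V) (s s' a b : R).
Hypotheses (h1 : N h = 1) (k1 : N k = 1) (hk1 : N (k - h) = 1).
Hypotheses (p1 : N p = 1) (q1 : N q = 1).
Hypotheses (hs : polar h s) (ks : polar k s') (pa : polar p a) (qb : polar q b).

Lemma step_ge1 : a <= s -> s < s' -> s' <= b -> b < a + pi -> 1 <= N (q - p).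
Proof.
move=> as_ ss' sb ba.
have D0 : 0 < det2 h k by apply: (polar_det2_gt0 hs ks); lra.
have qE := decompose q D0.
rewrite (det2C q k) (det2C q h) !mulNr !scaleNr opprK addrC in qE.
apply: (quadrilateral_ge1 nN h1 k1 hk1 _ _ _ _ p1 q1 (decompose p D0) qE).
- by rewrite divr_ge0 ?(ltW D0) //; apply: (polar_det2_ge0 pa ks); lra.
- by rewrite divr_ge0 ?(ltW D0) //; apply: (polar_det2_ge0 pa hs); lra.
- by rewrite divr_ge0 ?(ltW D0) //; apply: (polar_det2_ge0 ks qb); lra.
- by rewrite divr_ge0 ?(ltW D0) //; apply: (polar_det2_ge0 hs qb); lra.
Qed.

Lemma step_long : a <= s -> s < s' -> s' < b -> b < a + pi -> N (q - p) <= 1 ->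
  long N h \/ long N k.
Proof.
move=> as_ ss' sb ba.
have D0 : 0 < det2 h k by apply: (polar_det2_gt0 hs ks); lra.
have qE := decompose q D0.
rewrite (det2C q k) (det2C q h) !mulNr !scaleNr opprK addrC in qE.
apply: (quadrilateral_long nN h1 k1 hk1 _ _ _ _ p1 q1 (decompose p D0) qE).
- by rewrite divr_gt0 //; apply: (polar_det2_gt0 pa ks); lra.
- by rewrite divr_ge0 ?(ltW D0) //; apply: (polar_det2_ge0 pa hs); lra.
- by rewrite divr_gt0 //; apply: (polar_det2_gt0 ks qb); lra.
- by rewrite divr_gt0 //; apply: (polar_det2_gt0 hs qb); lra.
Qed.

End Step.

(** Indexing by all naturals lets a closed polygon be traversed repeatedly, so that a path can be
    compared with it from any vertex on. *)
Definition chain (h : nat -> V) (s : nat -> R) := forall i,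
  [/\ N (h i) = 1, N (h i.+1 - h i) = 1, polar (h i) (s i)
    & s i < s i.+1 < s i + pi].

Definition unit_path n (p : nat -> V) (t : nat -> R) :=
  (forall i, (i <= n)%N -> N (p i) = 1 /\ polar (p i) (t i)) /\
  (forall i, (i < n)%N -> t i < t i.+1 < t i + pi).

Lemma chain_shift h s j : chain h s ->
  chain (fun i => h (j + i)%N) (fun i => s (j + i)%N).
Proof. by move=> hs i; rewrite addnS; apply: hs. Qed.

Lemma chain_mono h s i j : chain h s -> (i <= j)%N -> s i <= s j.
Proof.
move=> hs; elim: j => [|j IHj]; first by rewrite leqn0 => /eqP ->.
rewrite leq_eqVlt => /predU1P[-> //|]; rewrite ltnS => /IHj /le_trans; apply.
by have [_ _ _] := hs j; lra.
Qed.

(** If the path is level or behind at step [i] and level or ahead at the next, its step spans a step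
    of the chain and has length at least 1 by [step_ge1]. *)
Lemma strict_path_lt_chain n p t h s : chain h s -> unit_path n p t ->
  (forall i, (i < n)%N -> N (p i.+1 - p i) < 1) -> t 0 <= s 0 ->
  forall i, (0 < i <= n)%N -> t i < s i.
Proof.
move=> hs [pt t_lt] p_lt t0 i; elim: i => // i IHi /= i_n.
have ti : t i <= s i.
  by case: i IHi i_n => [|i] IHi i_n //; apply: ltW; apply: IHi; exact: ltnW.
rewrite ltNge; apply/negP => st.
have [h1 hh1 hsi si] := hs i; have [h1' _ hsi' _] := hs i.+1.
have [p1 pti] := pt i (ltnW i_n); have [p1' pti'] := pt i.+1 i_n.
have /andP[_ ti_pi] := t_lt i i_n; have /andP[si_lt _] := si.
have := p_lt i i_n; rewrite ltNge => /negP; apply.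
exact: (step_ge1 h1 h1' hh1 p1 p1' hsi hsi' pti pti' ti si_lt st ti_pi).
Qed.

(** The same induction with [step_long]: a step of length at most 1 can overtake strictly only at a
    long vertex of the chain. *)
Lemma path_le_chain n p t h s : chain h s -> unit_path n p t ->
  (forall i, ~ long N (h i)) ->
  (forall i, (i < n)%N -> N (p i.+1 - p i) <= 1) -> t 0 <= s 0 ->
  forall i, (i <= n)%N -> t i <= s i.
Proof.
move=> hs [pt t_lt] nl p_lt t0 i; elim: i => // i IHi /= i_n.
have ti : t i <= s i by rewrite IHi // ltnW.
rewrite leNgt; apply/negP => st.
have [h1 hh1 hsi si] := hs i; have [h1' _ hsi' _] := hs i.+1.
have [p1 pti] := pt i (ltnW i_n); have [p1' pti'] := pt i.+1 i_n.
have /andP[_ ti_pi] := t_lt i i_n; have /andP[si_lt _] := si.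
have := step_long h1 h1' hh1 p1 p1' hsi hsi' pti pti' ti si_lt st ti_pi (p_lt i i_n).
by case; apply: nl.
Qed.

Definition period m (s : nat -> R) := forall i, s (i + m)%N = s i + 2 * pi.

Lemma chain_straddle m h s b : chain h s -> period m s -> s 0 < b ->
  exists j, s j < b <= s j.+1.
Proof.
move=> hs per sb.
have sm i : s (i * m)%N = s 0 + i%:R * (2 * pi).
  elim: i => [|i IHi]; first by rewrite mul0r addr0.
  by rewrite mulSn addnC per IHi -natr1; ring.
have [|j bj jmin] := @ex_minnP (fun j => b <= s j).
  pose i := Num.bound (`|b - s 0|); exists (i * m)%N; rewrite sm.
  have : `|b - s 0| < i%:R by apply: archi_boundP.
  have := ler_norm (b - s 0); have := @pi_ge2 R => ? ? ?.
  have : 0 <= i%:R :> R by [].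
  by nra.
case: j bj jmin => [|j] bj jmin; first by lra.
exists j; rewrite bj andbT ltNge; apply/negP => /jmin.
by rewrite ltnn.
Qed.

(** A path starting level with the chain falls strictly behind. If [n <= m], it would complete a
    turn in [n] steps while the chain, being ahead, makes at most one. *)
Lemma no_short_strict_path m n p t h s : chain h s -> period m s ->
  unit_path n p t -> (forall i, (i < n)%N -> N (p i.+1 - p i) < 1) ->
  t n = t 0 + 2 * pi -> t 0 = s 0 -> (m < n)%N.
Proof.
move=> hs per pt p_lt tn t0; rewrite ltnNge; apply/negP => nm.
have n0 : (0 < n)%N.
  by case: n tn {pt p_lt nm} => // tn; have := @pi_ge2 R; lra.
have tn_lt : t n < s n.
  by apply: (strict_path_lt_chain hs pt p_lt); rewrite ?t0 ?n0 /=.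
by have := chain_mono hs nm; rewrite -[m]add0n per; lra.
Qed.

(** Let [s j < t 0 <= s (j + 1)]. With [n < m], the path would end at angle at most
    [s (j + 1 + n) <= s (j + m) = s j + 2 pi], which is less than [t 0 + 2 pi]. *)
Lemma no_shorter_path m n p t h s :
  chain h s -> period m s -> s 0 < t 0 -> unit_path n p t ->
  t n = t 0 + 2 * pi ->
  (forall i, (i < n)%N -> N (p i.+1 - p i) < 1) \/
  (forall i, (i < n)%N -> N (p i.+1 - p i) <= 1) /\ (forall i, ~ long N (h i)) ->
  (m <= n)%N.
Proof.
move=> hs per st pt tn p_lt; rewrite leqNgt; apply/negP => nm.
have [j /andP[sj tj]] := chain_straddle hs per st.
have hs' := chain_shift j.+1 hs.
have tj0 : t 0 <= s (j.+1 + 0)%N by rewrite addn0.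
have tn_le : t n <= s (j.+1 + n)%N.
  case: p_lt => [p_lt|[p_le nl]].
  - case: n tn pt p_lt {nm} => [|n] tn pt p_lt; first exact: tj0.
    by apply: ltW; apply: (strict_path_lt_chain hs' pt p_lt tj0); rewrite /= leqnn.
  - by apply: (path_le_chain hs' pt) => // i; apply: nl.
have : s (j.+1 + n)%N <= s (j + m)%N by apply: chain_mono hs _; rewrite addSnnS leq_add2l.
by rewrite per; lra.
Qed.

End Chains.

Section SymmetricChain.
Variable R : realType.
Notation V := 'rV[R]_2.
Variable N : V -> R.
Hypothesis nN : is_norm N.

(* [l] lists half of the vertices of a centrally symmetric polygon. *)
Definition symmetric_vertex (l : seq V) i : V :=
  (-1) ^+ (i %/ size l) *: l`_(i %% size l).

Lemma symmetric_vertexD l i : (0 < size l)%N ->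
  symmetric_vertex l (i + size l) = - symmetric_vertex l i.
Proof.
move=> l0; rewrite /symmetric_vertex modnDr divnDr ?dvdnn // divnn l0 addn1.
by rewrite exprS mulN1r scaleNr.
Qed.

Lemma symmetric_vertex_lt l i : (i < size l)%N -> symmetric_vertex l i = l`_i.
Proof. by move=> il; rewrite /symmetric_vertex divn_small // modn_small // scale1r. Qed.

Lemma symmetric_vertex_ind l (P : V -> Prop) : (0 < size l)%N ->
  (forall x, P x -> P (- x)) -> (forall i, (i < size l)%N -> P l`_i) ->
  forall i, P (symmetric_vertex l i).
Proof.
move=> l0 PN Pl i; have Pi : P l`_(i %% size l) by apply: Pl; rewrite ltn_mod.
rewrite /symmetric_vertex -signr_odd.
case: odd; rewrite ?expr1 ?expr0 ?scaleN1r ?scale1r //.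
exact: PN.
Qed.

Lemma symmetric_chain (l : seq V) (s0 : R) : (1 < size l)%N ->
  (forall i, (i < size l)%N -> N l`_i = 1) ->
  (forall i, (i.+1 < size l)%N -> N (l`_i.+1 - l`_i) = 1) ->
  N (l`_0 + l`_(size l).-1) = 1 ->
  (forall i, (0 < i < size l)%N -> 0 < det2 l`_0 l`_i) ->
  (forall i, (i.+1 < size l)%N -> 0 < det2 l`_i l`_i.+1) ->
  polar l`_0 s0 ->
  exists s, [/\ s 0%N = s0, chain N (symmetric_vertex l) s
    & period (size l).*2 s].
Proof.
move=> l_gt1 l1 ld lc l0i lii ls0; set k := size l in l_gt1 l1 ld lc l0i lii *.
have k0 : (0 < k)%N by apply: leq_trans l_gt1.
have [f fP] : {f : nat -> R & forall i, (i < k)%N ->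
    [/\ 0 <= f i, f i < pi, (i = 0%N -> f i = 0) & polar l`_i (s0 + f i)]}.
  apply: (@choice nat R (fun i y => (i < k)%N ->
    [/\ 0 <= y, y < pi, (i = 0%N -> y = 0) & polar l`_i (s0 + y)])) => i.
  have [ik|] := ltnP i k; last by exists 0.
  case: i ik => [|i] ik.
    by exists 0 => _; split; rewrite ?addr0 // pi_gt0.
  have [f /andP[f0 fpi] lf] := polar_upper ls0 (l0i i.+1 ik).
  by exists f => _; split => //; exact: ltW.
have f0 : f 0%N = 0 by have [_ _ -> //] := fP 0%N k0.
(* Each passage through [l] is a half turn; [f] gives the angle of the listed vertices relative to
   the first one. *)
pose s i := s0 + f (i %% k)%N + (i %/ k)%:R * pi.
pose h := symmetric_vertex l.
have sD i : s (i + k)%N = s i + pi.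
  rewrite /s modnDr divnDr ?dvdnn // divnn k0 addn1 -natr1; ring.
have hD i : h (i + k)%N = - h i by exact: symmetric_vertexD.
have s_lt i : (i < k)%N -> s i = s0 + f i.
  by move=> ik; rewrite /s modn_small // divn_small // mul0r addr0.
have h_lt i : (i < k)%N -> h i = l`_i by move=> ik; exact: symmetric_vertex_lt.
exists s; split; first by rewrite s_lt // f0 addr0.
- move=> i; rewrite -/h; elim/ltn_ind: i => i IHi.
  have [ki|ik] := leqP k i.
    have [|h1 hh1 hs /andP[s1 s2]] := IHi (i - k)%N; first by rewrite ltn_subrL k0 (leq_trans k0).
    rewrite -(subnK ki) -addSn !hD !sD; split.
    + by rewrite normN.
    + by rewrite -opprD normN // addrC // -[X in N X]opprK opprD opprK normN // addrC.
    + exact: polarN.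
    + by apply/andP; split; lra.
  have [fi0 fipi _ hsi] := fP i ik.
  have [ik'|] := ltnP i.+1 k.
    have [fi0' fipi' _ hsi'] := fP i.+1 ik'.
    rewrite !h_lt // !s_lt //; split => //; [exact: l1|exact: ld|].
    have ff := polar_lt hsi hsi' (lii i ik').
    by apply/andP; split; lra.
  move=> ki; have ikE : i = k.-1 by apply/eqP; rewrite eqn_leq -ltnS prednK // ik -ltnS prednK.
  have iS : i.+1 = (0 + k)%N by rewrite ikE prednK.
  rewrite iS hD sD !h_lt // !s_lt // f0; split => //; [exact: l1| |].
  + by rewrite -normN // opprB opprK addrC ikE.
  + have i0 : (0 < i)%N by rewrite ikE -ltnS prednK.
    have [_ _ _ hs0] := fP 0%N k0.
    have fi_gt0 := polar_lt hs0 hsi (l0i i _).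
    by rewrite i0 ik f0 in fi_gt0; have := fi_gt0 isT => ?; apply/andP; split; lra.
- by move=> i; rewrite -addnn addnA !sD; ring.
Qed.

End SymmetricChain.

Lemma convex_setE (R : realType) (A : set 'rV[R]_2) :
  @convex_set R 'rV[R]_2 A <-> forall x y (a b : R), A x -> A y ->
    0 <= a -> 0 <= b -> a + b = 1 -> A (a *: x + b *: y).
Proof.
split=> [cA x y a b Ax Ay a0 b0 ab|cA x y l].
- have a1 : a <= 1 by lra.
  have := cA x y (Itv01 a0 a1); rewrite !inE => /(_ Ax Ay).
  by rewrite /conv /= /unstable.onem (_ : b = 1 - a) //; lra.
- rewrite !inE => Ax Ay; rewrite /conv /= /unstable.onem.
  by apply: cA; rewrite ?subr_ge0 // addrC subrK.
Qed.

(** * Lower bounds *)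

Section Families.
Variable R : realType.
Notation V := 'rV[R]_2.
Variable N : V -> R.
Hypothesis nN : is_norm N.

Definition unit_family n (x : 'I_n -> V) :=
  [/\ cyclically_ordered x, forall i, N (x i) = 1 & convex_hull (range x) 0].

(* If the family skipped an angle larger than [pi] after [p], it would lie in this
   convex set, which misses the origin. *)
Let half_plane (p : V) : set V :=
  [set z | det2 p z < 0 \/ exists2 a : R, 0 < a & z = a *: p].

Let half_plane_convex p : @convex_set R V (half_plane p).
Proof.
have det_le z : half_plane p z -> det2 p z <= 0.
  by case=> [/ltW//|[a _ ->]]; rewrite !det2E mulr0.
apply/convex_setE => x y a b px py a0 b0 ab.
have [ea|a_neq0] := eqVneq a 0.
  by rewrite ea scale0r add0r (_ : b = 1) ?scale1r //; lra.
have [eb|b_neq0] := eqVneq b 0.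
  by rewrite eb scale0r addr0 (_ : a = 1) ?scale1r //; lra.
have a_gt0 : 0 < a by rewrite lt_neqAle eq_sym a_neq0.
have b_gt0 : 0 < b by rewrite lt_neqAle eq_sym b_neq0.
have px_le := det_le _ px; have py_le := det_le _ py.
case: px => [px|[c c0 ->]]; first by left; rewrite !det2E; nra.
case: py => [py|[c' c'0 ->]]; first by left; rewrite !det2E; nra.
right; exists (a * c + b * c'); last by vec.
by rewrite addr_gt0 // mulr_gt0.
Qed.

(** The cyclic family is unrolled into a closed path. Its turns are less than [pi]: a turn of [pi]
    joins opposite vectors, at distance 2, and a larger one puts the family in [half_plane], against
    the hull condition. *)
Lemma family_path n (x : 'I_n -> V) : unit_family x ->
  (forall i, N (x i - x (ordS i)) <= 1) ->
  exists p t, [/\ (0 < n)%N, unit_path N n p t, t n = t 0%N + 2 * pi, p n = p 0%N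
    & forall i, (i < n)%N -> exists j, p i = x j /\ p i.+1 = x (ordS j)].
Proof.
case: n x => [|n] x [[r [t [r0 xE tlt t2pi]]] x1 hull] xd.
  exfalso; have : (set0 : set V) 0.
    have: @convex_set R V set0 by apply/convex_setE.
    move=> /(smallest_sub (G := range x)) /(_ _); apply => //.
    by move=> ? [[]].
  by [].
(* The additional last index repeats the first vector, one turn later. *)
pose p i := if (i < n.+1)%N then x (inord i) else x ord0.
pose t' i := if (i < n.+1)%N then t (inord i) else t ord0 + 2 * pi.
have px i : (i < n.+1)%N -> p i = x (inord i) by rewrite /p => ->.
have tx i : (i < n.+1)%N -> t' i = t (inord i) by rewrite /t' => ->.
have inord0 : inord 0 = ord0 :> 'I_n.+1 by apply/val_inj; rewrite /= inordK.
have pn : p n.+1 = x ord0 by rewrite /p ltnn.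
have tn : t' n.+1 = t ord0 + 2 * pi by rewrite /t' ltnn.
have px0 : p 0%N = x ord0 by rewrite px // inord0.
have tx0 : t' 0%N = t ord0 by rewrite tx // inord0.
have xpolar j : polar (x j) (t j) by exists (r j); [exact: r0|exact: xE].
have pS i : (i < n.+1)%N -> p i.+1 = x (ordS (inord i)).
  move=> i_n; have [i_n'|] := ltnP i.+1 n.+1.
    rewrite px //; congr x; apply/val_inj.
    by rewrite /= !inordK // modn_small.
  move=> n_i; have -> : i = n by apply/eqP; rewrite eqn_leq -ltnS i_n.
  by rewrite pn; congr x; apply/val_inj; rewrite /= inordK // modnn.
have ppolar i : (i <= n.+1)%N -> N (p i) = 1 /\ polar (p i) (t' i).
  rewrite leq_eqVlt => /predU1P[->|i_n]; last by rewrite px // tx.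
  by rewrite pn tn; split => //; apply: polarD2pi.
have t'_lt i : (i < n.+1)%N -> t' i < t' i.+1.
  move=> i_n; have [i_n'|n_i] := ltnP i.+1 n.+1.
    by rewrite !tx // tlt // !inordK.
  by rewrite tx // /t' ltnNge n_i /= t2pi.
exists p, t'; split => //; [|by rewrite tn tx0|by rewrite pn px0|]; last first.
  by move=> i i_n; exists (inord i); rewrite px // pS.
split => // i i_n; rewrite t'_lt //= ltNge; apply/negP.
rewrite le_eqVlt => /predU1P[tE|t_gt].
- have [p1 pi_polar] := ppolar i (ltnW i_n).
  have [pS1 pS_polar] := ppolar i.+1 i_n.
  have [a a0 pSE] := pS_polar; have [b b0 pE] := pi_polar.
  have : det2 (p i) (p i.+1) = 0.
    by rewrite pSE pE -tE directionDpi det2Zl det2Zr det2Nr det2xx oppr0 !mulr0.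
  move=> /(norm_unit_eq0 nN p1 pS1) [pp|pp].
  + have : (a + b) *: direction (t' i) = 0.
      rewrite scalerDl -pE -pp pSE -tE directionDpi scalerN.
      by rewrite addrN.
    move=> /(congr1 N); rewrite normZ // norm0 // ger0_norm ?addr_ge0 ?ltW //.
    move=> /eqP; rewrite mulf_eq0 => /orP[/eqP|/eqP Nd]; first by lra.
    by move: p1; rewrite pE normZ // Nd mulr0; lra.
  + have := xd (inord i); rewrite -px // -pS // pp opprK.
    rewrite (_ : p i + p i = 2 *: p i); last by vec.
    by rewrite normZ // p1 ger0_norm; lra.
- have [p1 pi_polar] := ppolar i (ltnW i_n).
  have p0 := norm1_neq0 nN p1.
  have : half_plane (p i) 0.
    apply: (@smallest_sub V (@convex_set R V) (range x) (half_plane (p i)) _ _ 0 hull).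
      exact: half_plane_convex.
    move=> _ [j _ <-].
    (* After a gap larger than [pi], the vectors other than [p i] all lie strictly clockwise of it
       by less than [pi]; those listed after it are compared with its angle increased by one
       turn. *)
    have [ji|ij|ji] := ltngtP j (inord i : 'I_n.+1).
    + left; rewrite -oppr_gt0 -det2Nr.
      apply: (polar_det2_gt0 pi_polar (polarN (xpolar j))).
      have := tlt _ _ ji; rewrite -tx // => tji.
      have t0j : t ord0 <= t j.
        have [->//|j0] := eqVneq j ord0.
        by apply: ltW; apply: tlt; rewrite lt0n; apply: contra_neq j0 => j0; apply/val_inj.
      have t'S : t' i.+1 <= t ord0 + 2 * pi.
        rewrite /t'; case: ifP => // _; exact/ltW/t2pi.
      by apply/andP; split; lra.
    + left; rewrite -oppr_gt0 -det2Nr.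
      apply: (polar_det2_gt0 (polarD2pi pi_polar) (polarN (xpolar j))).
      have := t2pi (inord i) j; rewrite -tx // => tji.
      have tSj : t' i.+1 <= t j.
        rewrite inordK // in ij.
        have i_n' : (i.+1 < n.+1)%N by apply: leq_ltn_trans ij (ltn_ord j).
        rewrite tx //.
        have [->//|nj] := eqVneq j (inord i.+1).
        apply: ltW; apply: tlt; rewrite inordK // ltn_neqAle ij andbT.
        by apply: contra_neq nj => nj; apply/val_inj; rewrite /= inordK.
      by apply/andP; split; lra.
    + by right; exists 1 => //; rewrite scale1r px //; congr x; apply/val_inj.
  case=> [|[a a0]]; first by rewrite /det2 !mxE; lra.
  move=> /esym/eqP; rewrite scaler_eq0 (negPf p0) orbF => /eqP; lra.
Qed.

Lemma family_ge4 n (x : 'I_n -> V) : unit_family x ->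
  (forall i, N (x i - x (ordS i)) <= 1) -> (4 <= n)%N.
Proof.
move=> fx xd; have [p [t [n0 [pt t_lt] tn pn step]]] := family_path fx xd.
have pd i : (i < n)%N -> N (p i - p i.+1) <= 1.
  by move=> /step [j [-> ->]].
case: n x fx xd n0 pt t_lt tn pn step pd => [//|[|[|[|n]]]] x fx xd _ pt t_lt tn pn _ pd //.
- by have := t_lt 0%N isT; lra.
- by have := t_lt 0%N isT; have := t_lt 1%N isT; lra.
- have [[p01 p0] [p11 p1]] := (pt 0%N isT, pt 1%N isT).
  have [[p21 p2] [_ p3]] := (pt 2%N isT, pt 3%N isT).
  have d01 := polar_det2_gt0 p0 p1 (t_lt 0%N isT).
  have d12 := polar_det2_gt0 p1 p2 (t_lt 1%N isT).
  have d23 := polar_det2_gt0 p2 p3 (t_lt 2%N isT).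
  rewrite pn in d23; exfalso.
  (* With three vectors, this rewrites the vanishing combination whose coefficients are the opposite
     determinants. As [p 0] is within 1 of the other two, the norms force
     [det2 (p 1) (p 2) <= 0]. *)
  have E : (det2 (p 1%N) (p 2%N) + det2 (p 2%N) (p 0%N) + det2 (p 0%N) (p 1%N)) *: p 0%N
    = det2 (p 2%N) (p 0%N) *: (p 0%N - p 1%N) + det2 (p 0%N) (p 1%N) *: (p 0%N - p 2%N).
    by apply: rV2P; rewrite /det2 !mxE; ring.
  have := norm_le2 nN (ltW d23) (ltW d01) E.
  rewrite normZ // p01 mulr1 ger0_norm; last by lra.
  have := pd 0%N isT; have := pd 2%N isT; rewrite pn (normB nN (p 2%N)).
  by nra.
Qed.

Let path_lt n (x : 'I_n -> V) p i :
  (exists j, p i = x j /\ p i.+1 = x (ordS j)) ->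
  (forall i, N (x i - x (ordS i)) < 1) -> N (p i.+1 - p i) < 1.
Proof. by move=> [j [-> ->]] xd; rewrite normB. Qed.

Lemma hexagon_chain u v s0 : N u = 1 -> N v = 1 -> N (v - u) = 1 ->
  0 < det2 u v -> polar u s0 -> exists s, [/\ s 0%N = s0,
    chain N (symmetric_vertex [:: u; v; v - u]) s & period 6 s].
Proof.
move=> u1 v1 vu1 uv us0.
apply: (@symmetric_chain _ _ nN [:: u; v; v - u] s0) => //=.
- by case=> [|[|[|//]]].
- case=> [|[|//]] _ //=.
  by rewrite (_ : _ - _ = - u) ?normN //; vec.
- by rewrite addrC subrK.
- by case=> [|[|[|//]]] _ //=; rewrite !det2E; lra.
- by case=> [|[|//]] _ //=; rewrite !det2E (det2C v u); lra.
Qed.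

(** Starting the chain at the first member of the family makes [no_short_strict_path] applicable,
    whose strict bound gives 7 rather than 6. *)
Lemma strict_family_ge7 n (x : 'I_n -> V) : unit_family x ->
  (forall i, N (x i - x (ordS i)) < 1) -> (7 <= n)%N.
Proof.
move=> fx xd.
have [p [t [n0 pt tn pn step]]] := family_path fx (fun i => ltW (xd i)).
have [p01 p0] := pt.1 0%N isT.
have [v [v1 vu1 uv]] := exists_hexagon nN p01.
have [s [s0 hs per]] := hexagon_chain p01 v1 vu1 uv p0.
apply: (no_short_strict_path nN hs per pt) => // i i_n.
exact: path_lt (step i i_n) xd.
Qed.

Lemma family_ge6 n (x : 'I_n -> V) u v : good_hexagon N u v -> unit_family x ->
  (forall i, N (x i - x (ordS i)) <= 1) -> (6 <= n)%N.
Proof.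
move=> [u1 v1 vu1 uv [nlu nlv nlw]] fx xd.
have [p [t [n0 pt tn pn step]]] := family_path fx xd.
have [s0 us0 s0_lt] := polar_exists_lt (t 0%N) (norm1_neq0 nN u1).
have [s [s0E hs per]] := hexagon_chain u1 v1 vu1 uv us0.
apply: (no_shorter_path nN hs per _ pt tn); first by rewrite s0E.
right; split=> [i i_n|]; first by have [j [-> ->]] := step i i_n; rewrite normB.
apply: (@symmetric_vertex_ind _ _ (fun y => ~ long N y)) => //= [y nly lNy|[|[|[|//]]] _ //].
by apply: nly; rewrite -(opprK y); apply: longN.
Qed.

(** By homogeneity both sides have the same sublevel sets at every positive level. *)
Lemma parallelogram_normE d m a b : parallelogram_norm N d m ->
  N (a *: d + b *: m) = Num.max `|a| `|b|.
Proof.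
move=> pN; set z := a *: d + b *: m.
have zr r : 0 < r -> (N z <= r) = (Num.max `|a| `|b| <= r).
  move=> r0; have := pN (r^-1 * a) (r^-1 * b).
  have ri : 0 < r^-1 by rewrite invr_gt0.
  rewrite (_ : _ + _ = r^-1 *: z); last by rewrite scalerDr !scalerA.
  rewrite (normZ nN) !normrM (gtr0_norm ri) !(mulrC r^-1) !ler_pdivrMr // !mul1r.
  by rewrite ge_max.
have z0 := norm_ge0 nN z.
have m0 : 0 <= Num.max `|a| `|b| by rewrite le_max normr_ge0.
apply/eqP; rewrite eq_le; apply/andP; split; apply/ler_addgt0Pr => e e0.
- by rewrite zr ?ler_wpDr // ?ltW //; lra.
- by rewrite -zr ?ler_wpDr // ?ltW //; lra.
Qed.

(** The octagon [d], [d + m], [m], [m - d] and opposites alternates midpoints of sides and corners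
    of the ball; all its steps have norm 1. *)
Lemma strict_family_ge8 n (x : 'I_n -> V) d m : 0 < det2 d m ->
  parallelogram_norm N d m -> unit_family x ->
  (forall i, N (x i - x (ordS i)) < 1) -> (8 <= n)%N.
Proof.
move=> dm pN fx xd.
have NE a b z : z = a *: d + b *: m -> N z = Num.max `|a| `|b|.
  by move=> ->; exact: parallelogram_normE.
have d1 : N d = 1.
  by rewrite (NE 1 0) ?normr1 ?normr0 ?maxEle ?ler10 //; vec.
have m1 : N m = 1.
  by rewrite (NE 0 1) ?normr1 ?normr0 ?maxEle ?ler01 //; vec.
have s1 : N (d + m) = 1 by rewrite (NE 1 1) ?normr1 ?maxxx //; vec.
have b1 : N (m - d) = 1 by rewrite (NE (-1) 1) ?normrN ?normr1 ?maxxx //; vec.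
have [p [t [n0 pt tn pn step]]] := family_path fx (fun i => ltW (xd i)).
have [s0 ds0 s0_lt] := polar_exists_lt (t 0%N) (norm1_neq0 nN d1).
have [s [s0E hs per]] : exists s, [/\ s 0%N = s0,
    chain N (symmetric_vertex [:: d; d + m; m; m - d]) s & period 8 s].
  apply: (@symmetric_chain _ _ nN [:: d; d + m; m; m - d] s0) => //=.
  - by case=> [|[|[|[|//]]]].
  - case=> [|[|[|//]]] _ //=.
    + by rewrite (_ : _ - _ = m) //; vec.
    + by rewrite (_ : _ - _ = - d) ?normN //; vec.
    + by rewrite (_ : _ - _ = - d) ?normN //; vec.
  - by rewrite addrC subrK.
  - by case=> [|[|[|[|//]]]] _ //=; rewrite !det2E; lra.
  - by case=> [|[|[|//]]] _ //=; rewrite !det2E ?(det2C m d); lra.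
apply: (no_shorter_path nN hs per _ pt tn); first by rewrite s0E.
by left=> i i_n; apply: path_lt (step i i_n) xd.
Qed.

End Families.

(** * Upper bounds *)

Section Constructions.
Variable R : realType.
Notation V := 'rV[R]_2.

Definition upper (b y : V) := 0 < det2 b y \/ y = b.

Lemma upper_polar (b y : V) t : polar b t -> upper b y ->
  exists2 f, 0 <= f < pi & polar y (t + f).
Proof.
move=> bt [by_|->]; last by exists 0; rewrite ?addr0 ?lexx ?pi_gt0.
have [f /andP[f0 fpi] yf] := polar_upper bt by_.
by exists f; rewrite ?(ltW f0).
Qed.

(** The first [k] vectors have angles in [[0, pi)] from [b], the others in [[pi, 2 pi)].
    Determinants order the angles within each half, and the value [pi] separates the halves. *)
Lemma cyclically_ordered_split n k (b : V) (x : nat -> V) : b != 0 ->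
  (forall i, (i < k)%N -> upper b (x i)) ->
  (forall i, (k <= i < n)%N -> upper b (- x i)) ->
  (forall i, (i.+1 < n)%N -> i.+1 != k -> 0 < det2 (x i) (x i.+1)) ->
  cyclically_ordered (fun i : 'I_n => x i).
Proof.
move=> b0 xu xl xx; have [t bt] := polar_exists b0.
have [f fP] : {f : nat -> R & forall i, (i < n)%N -> polar (x i) (t + f i) /\
    (if (i < k)%N then 0 <= f i < pi else pi <= f i < 2 * pi)}.
  apply: (@choice nat R (fun i y => (i < n)%N -> polar (x i) (t + y) /\
    (if (i < k)%N then 0 <= y < pi else pi <= y < 2 * pi))) => i.
  have [i_n|] := ltnP i n; last by exists 0.
  have [ik|ki] := ltnP i k.
    by have [y y0 xy] := upper_polar bt (xu i ik); exists y.
  have [|y /andP[y0 ypi] xy] := @upper_polar b (- x i) t bt; first by apply: xl; rewrite ki.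
  exists (y + pi) => _; rewrite addrA -[x i]opprK; split; first exact: polarN.
  by apply/andP; split; lra.
have f_lt i j : (i < j)%N -> (j < n)%N -> f i < f j.
  elim: j => // j IHj; rewrite ltnS leq_eqVlt => ij j_n.
  have fj : f j < f j.+1.
    have [xj fj] := fP j (ltnW j_n); have [xj' fj'] := fP j.+1 j_n.
    have [jk|jk] := eqVneq j.+1 k.
      by move: fj fj'; rewrite -jk ltnn ltnSn; lra.
    rewrite -(ltrD2l t); apply: (polar_lt xj xj' (xx j j_n jk)).
    have jk' : (j.+1 < k)%N = (j < k)%N by rewrite [RHS]leq_eqVlt (negPf jk).
    by move: fj fj'; rewrite jk'; case: ifP => _; lra.
  by case/predU1P: ij => [->//|ij]; apply: lt_trans fj; apply: IHj => //; exact: ltnW.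
have f_itv i : (i < n)%N -> 0 <= f i < 2 * pi.
  move=> i_n; have [_] := fP i i_n; have := @pi_ge2 R.
  by case: ifP => _; lra.
have [r rP] : {r : 'I_n -> R & forall i : 'I_n, 0 < r i /\
    x i = r i *: direction (t + f i)}.
  apply: (@choice 'I_n R (fun i y => 0 < y /\ x i = y *: direction (t + f i))) => i.
  by have [[y y0 xE] _] := fP i (ltn_ord i); exists y.
exists r, (fun i : 'I_n => t + f i); split.
- by move=> i; have [] := rP i.
- by move=> i; have [] := rP i.
- by move=> i j ij; rewrite ltrD2l f_lt.
- by move=> i j; have := f_itv i (ltn_ord i); have := f_itv j (ltn_ord j); lra.
Qed.

Lemma convex_hull_comb3 (X : set V) p q r (a b c : R) : X p -> X q -> X r ->
  0 < a -> 0 < b -> 0 < c -> a *: p + b *: q + c *: r = 0 -> convex_hull X 0.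
Proof.
move=> Xp Xq Xr a0 b0 c0 E A [cA XA].
have {}cA := (convex_setE A).1 cA.
have ab : 0 < a + b by lra.
have abc : 0 < a + b + c by lra.
have Apq : A ((a / (a + b)) *: p + (b / (a + b)) *: q).
  apply: cA; [exact: XA|exact: XA| | |].
  - by rewrite divr_ge0 // ltW.
  - by rewrite divr_ge0 // ltW.
  - by rewrite -mulrDl divff // gt_eqF.
have := cA _ _ ((a + b) / (a + b + c)) (c / (a + b + c)) Apq (XA _ Xr).
rewrite (_ : _ *: _ + _ *: r = (a + b + c)^-1 *: (a *: p + b *: q + c *: r)).
  rewrite E scaler0; apply.
  - by rewrite divr_ge0 // ltW.
  - by rewrite divr_ge0 // ltW.
  - by rewrite -mulrDl divff // gt_eqF.
apply/rowP => i; rewrite !mxE; field.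
by rewrite !gt_eqF.
Qed.

Variable N : V -> R.
Hypothesis nN : is_norm N.

(** The predicate [P] stands for either bound on the steps, [N y <= 1] or [N y < 1]. Central
    symmetry reduces all conditions to one half of the family. *)
Lemma symmetric_family (l : seq V) (P : V -> Prop) : (1 < size l)%N ->
  (forall i, (i < size l)%N -> N l`_i = 1) ->
  (forall i, (0 < i < size l)%N -> 0 < det2 l`_0 l`_i) ->
  (forall i, (i.+1 < size l)%N -> 0 < det2 l`_i l`_i.+1) ->
  (forall y, P y -> P (- y)) ->
  (forall i, (i.+1 < size l)%N -> P (l`_i - l`_i.+1)) ->
  P (l`_(size l).-1 + l`_0) ->
  let x (i : 'I_(size l).*2) := symmetric_vertex l i in
  unit_family N x /\ forall i, P (x i - x (ordS i)).
Proof.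
move=> l_gt1 l1 l0i lii PN Pl Plast; set k := size l in l_gt1 l1 l0i lii Pl Plast *.
have k0 : (0 < k)%N by apply: leq_trans l_gt1.
pose h := symmetric_vertex l.
have hD i : h (i + k)%N = - h i by exact: symmetric_vertexD.
have hk : h k = - h 0%N := hD 0%N.
have h_lt i : (i < k)%N -> h i = l`_i by exact: symmetric_vertex_lt.
have hB i : (k <= i)%N -> h i = - h (i - k)%N by move=> ki; rewrite -hD subnK.
have h1 : forall i, N (h i) = 1.
  by apply: (symmetric_vertex_ind (P := fun y => N y = 1)) => // y; rewrite normN.
have kk i : (i < k.*2)%N -> (k <= i)%N -> (i - k < k)%N.
  by move=> ik ki; rewrite ltn_subLR // addnn.
have hPS i : (i < k)%N -> P (h i - h i.+1).
  move=> ik; have [ik'|ki] := ltnP i.+1 k; first by rewrite !h_lt //; exact: Pl.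
  have iE : i = k.-1 by apply/eqP; rewrite eqn_leq -ltnS prednK // ik -ltnS prednK.
  rewrite (hB _ ki) (_ : (i.+1 - k)%N = 0%N); last by rewrite iE prednK // subnn.
  by rewrite opprK !h_lt // iE.
split; [split|].
- apply: (@cyclically_ordered_split _ k l`_0 h).
  + by apply: (norm1_neq0 nN); exact: l1.
  + by move=> [|i] ik; rewrite h_lt //; [right|left; exact: l0i].
  + move=> i /andP[ki i_n]; rewrite hB // opprK h_lt; last exact: kk.
    by case: (i - k)%N (kk i i_n ki) => [|j] jk; [right|left; exact: l0i].
  + move=> i i_n ik; have [ik'|ki] := ltnP i.+1 k.
      by rewrite !h_lt //; [exact: lii|exact: ltnW].
    have {}ki : (k <= i)%N by rewrite -ltnS ltn_neqAle eq_sym ik.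
    rewrite (hB _ ki) (hB _ (leqW ki)) det2Nl det2Nr opprK subSn //.
    have := kk _ i_n (leqW ki); rewrite subSn // => ikk.
    by rewrite !h_lt //; [exact: lii|exact: ltnW].
- by move=> i; exact: h1.
- have k2 : (k < k.*2)%N by rewrite -addnn -[X in (X < _)%N]addn0 ltn_add2l.
  have k20 : (0 < k.*2)%N by apply: leq_ltn_trans k2.
  pose x (i : 'I_k.*2) := h i.
  (* The origin is the midpoint of the first vector and its opposite; the latter is taken twice to
     make three points. *)
  apply: (@convex_hull_comb3 _ (x (Ordinal k20)) (x (Ordinal k2)) (x (Ordinal k2))
    2 1 1) => //.
  by rewrite /x /= hk; vec.
- move=> i; have i_n := ltn_ord i; rewrite -/h -/(h _).
  have -> : h (ordS i) = h i.+1.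
    rewrite /=; have [i_n'|n_i] := ltnP i.+1 k.*2; first by rewrite modn_small.
    have -> : i.+1 = k.*2 by apply/eqP; rewrite eqn_leq i_n.
    by rewrite modnn -addnn hD hk opprK.
  have [ik|ki] := ltnP i k; first exact: hPS.
  rewrite (hB _ ki) (hB _ (leqW ki)) subSn // -opprD.
  by apply: PN; apply: hPS; exact: kk.
Qed.

End Constructions.

Section SmallFamilies.
Variable R : realType.
Notation V := 'rV[R]_2.
Variable N : V -> R.
Hypothesis nN : is_norm N.

Lemma family_of_6 u v : N u = 1 -> N v = 1 -> N (v - u) = 1 -> 0 < det2 u v ->
  exists2 x : 'I_6 -> V, unit_family N x & forall i, N (x i - x (ordS i)) <= 1.
Proof.
move=> u1 v1 vu1 uv.
have [||||||| fx xd] := @symmetric_family _ N nN [:: u; v; v - u] (fun y => N y <= 1).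
- by [].
- by case=> [|[|[|//]]].
- by case=> [|[|[|//]]] _ //=; rewrite !det2E; lra.
- by case=> [|[|//]] _ //=; rewrite !det2E (det2C v u); lra.
- by move=> y; rewrite normN.
- case=> [|[|//]] _ //=; first by rewrite (normB nN) vu1.
  by rewrite (_ : _ - _ = u) ?u1 //; vec.
- by rewrite /= subrK v1.
by exists (fun i : 'I_6 => symmetric_vertex [:: u; v; v - u] i).
Qed.

Section ParallelogramNorm.
Variables d m : V.
Hypotheses (dm : 0 < det2 d m) (pN : parallelogram_norm N d m).

Let normE (a b : R) z : z = a *: d + b *: m -> N z = Num.max `|a| `|b|.
Proof. by move=> ->; exact: parallelogram_normE. Qed.

Lemma family_of_4 :
  exists2 x : 'I_4 -> V, unit_family N x & forall i, N (x i - x (ordS i)) <= 1.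
Proof.
have [||||||| fx xd] := @symmetric_family _ N nN [:: d; m] (fun y => N y <= 1).
- by [].
- case=> [|[|//]] _ /=.
  + by rewrite (@normE 1 0) ?normr1 ?normr0 ?maxEle ?ler10 //; vec.
  + by rewrite (@normE 0 1) ?normr1 ?normr0 ?maxEle ?ler01 //; vec.
- by case=> [|[|//]].
- by case=> [|//].
- by move=> y; rewrite normN.
- case=> [|//] _ /=.
  by rewrite (@normE 1 (-1)) ?normrN ?normr1 ?maxxx //; vec.
- by rewrite /= (@normE 1 1) ?normr1 ?maxxx //; vec.
by exists (fun i : 'I_4 => symmetric_vertex [:: d; m] i).
Qed.

Lemma strict_family_of_8 :
  exists2 x : 'I_8 -> V, unit_family N x & forall i, N (x i - x (ordS i)) < 1.
Proof.
(* Two points on each side, at distance [a] from its midpoint, are [2 a] apart, and [1 - a] apart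
   across a corner; [1 / 3] makes both distances [2 / 3]. *)
pose a : R := 1 / 3.
have aE : a = 1 / 3 by [].
have aV : `|a| = 1 / 3 by rewrite /a ger0_norm; lra.
have a2 : `|a *+ 2| = 2 / 3 by rewrite ger0_norm -mulr_natl /a; lra.
have dm0 := dm.
clearbody a.
pose l := [:: d - a *: m; d + a *: m; a *: d + m; m - a *: d].
have max1 : Num.max 1 (1 / 3 : R) = 1 by rewrite max_l //; lra.
have max1' : Num.max (1 / 3 : R) 1 = 1 by rewrite max_r //; lra.
have max0 : Num.max 0 (2 / 3 : R) = 2 / 3 by rewrite max_r //; lra.
have max0' : Num.max (2 / 3 : R) 0 = 2 / 3 by rewrite max_l //; lra.
have [||||||| fx xd] := @symmetric_family _ N nN l (fun y => N y < 1).
- by [].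
- case=> [|[|[|[|//]]]] _ /=.
  + by rewrite (@normE 1 (- a)) ?normrN ?aV ?normr1 //; vec.
  + by rewrite (@normE 1 a) ?aV ?normr1 //; vec.
  + by rewrite (@normE a 1) ?aV ?normr1 //; vec.
  + by rewrite (@normE (- a) 1) ?normrN ?aV ?normr1 //; vec.
- by case=> [|[|[|[|//]]]] _ //=; rewrite !det2E ?(det2C m d) aE; lra.
- by case=> [|[|[|//]]] _ //=; rewrite !det2E ?(det2C m d) aE; lra.
- by move=> y; rewrite normN.
- case=> [|[|[|//]]] _ /=.
  + rewrite (@normE 0 (- (a *+ 2))) ?normrN ?a2 ?normr0 ?max0; [lra|vec].
  + rewrite (@normE (1 - a) (a - 1)) ?aE; last by vec.
    by rewrite distrC maxxx ler0_norm; lra.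
  + rewrite (@normE (a *+ 2) 0) ?a2 ?normr0 ?max0'; [lra|vec].
- rewrite /= (@normE (1 - a) (1 - a)) ?aE; last by vec.
  by rewrite maxxx ger0_norm; lra.
by exists (fun i : 'I_8 => symmetric_vertex l i).
Qed.

End ParallelogramNorm.

(** Going backwards from [u], each vertex is replaced by a vector slightly before it, close enough
    to stay within distance less than 1 of the vector chosen last. The new vector is also at
    distance less than 1 from the preceding vertex, which leaves room for the next move. The first
    move turns [u] into [p7]; [u] itself is kept as well, whence seven vectors. *)
Lemma strict_family_of_7 u v : good_hexagon N u v ->
  exists2 x : 'I_7 -> V, unit_family N x & forall i, N (x i - x (ordS i)) < 1.
Proof.
move=> [u1 v1 vu1 uv [nlu nlv nlw]]; set w := v - u in vu1 nlw.
have NN y : N (- y) = N y by exact: normN.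
have nlN y : ~ long N y -> ~ long N (- y).
  by move=> nly lNy; apply: nly; rewrite -(opprK y); exact: longN.
have lt_step h p q (e : R) : N (p - h) < 1 - e -> N (q - h) <= e -> N (p - q) < 1.
  move=> ph qh; have := normD nN (p - h) (h - q).
  by rewrite addrA subrK (normB nN h); lra.
have arc h k q : N h = 1 -> N k = 1 -> N (k - h) = 1 -> ~ long N h ->
    N (q - k) < 1 -> exists p (a b : R),
    [/\ 0 < a, 0 < b, p = a *: h + b *: k, N p = 1
      & N (p - q) < 1 /\ N (p - h) < 1].
  move=> h1 k1 hk1 nl qk; have e0 : 0 < 1 - N (q - k) by lra.
  have [p [a [b [a0 b0 pE p1 [pk ph]]]]] := arc_near nN h1 k1 hk1 e0 nl.
  exists p, a, b; split => //; split => //.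
  exact: lt_step pk (lexx _).
have uu0 : N (u - u) < 1 by rewrite subrr (norm0 nN).
have w1 : N (- w) = 1 by rewrite NN.
have [||||p7 [a7 [b7 [a7_0 b7_0 p7E p7_1 [p7u p7w]]]]] := arc (- w) u u _ _ _ _ uu0.
- by []. - by [].
- by rewrite (_ : _ - _ = v) //; rewrite /w; vec.
- exact: nlN.
have [||||p6 [a6 [b6 [a6_0 b6_0 p6E p6_1 [p67 p6v]]]]] := arc (- v) (- w) p7 _ _ _ _ p7w.
- by rewrite NN. - by [].
- by rewrite (_ : _ - _ = u) //; rewrite /w; vec.
- exact: nlN.
have [||||p5 [a5 [b5 [a5_0 b5_0 p5E p5_1 [p56 p5u]]]]] := arc (- u) (- v) p6 _ _ _ _ p6v.
- by rewrite NN. - by rewrite NN.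
- by rewrite (_ : _ - _ = - w) //; rewrite /w; vec.
- exact: nlN.
have [||||p4 [a4 [b4 [a4_0 b4_0 p4E p4_1 [p45 p4w]]]]] := arc w (- u) p5 _ _ _ _ p5u.
- by []. - by rewrite NN.
- by rewrite (_ : _ - _ = - v) ?NN //; rewrite /w; vec.
- by [].
have [||||p3 [a3 [b3 [a3_0 b3_0 p3E p3_1 [p34 p3v]]]]] := arc v w p4 _ _ _ _ p4w.
- by []. - by [].
- by rewrite (_ : _ - _ = - u) ?NN //; rewrite /w; vec.
- by [].
have [||||p2 [a2 [b2 [a2_0 b2_0 p2E p2_1 [p23 p2u]]]]] := arc u v p3 _ _ _ _ p3v.
- by []. - by []. - by []. - by [].
pose l := [:: u; p2; p3; p4; p5; p6; p7].
exists (fun i : 'I_7 => l`_i).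
- split.
  + apply: (@cyclically_ordered_split _ _ 4 u (fun i => l`_i)).
    * exact: (norm1_neq0 nN u1).
    * case=> [|[|[|[|//]]]] _ /=; first by right.
      - by left; rewrite p2E !det2E mulr0 add0r mulr_gt0.
      - by left; rewrite p3E /w !det2E oppr0 addr0 -mulrDl mulr_gt0 // addr_gt0.
      - by left; rewrite p4E /w !det2E oppr0 mulr0 !addr0 mulr_gt0.
    * case=> [|[|[|[|[|[|[|//]]]]]]] //= _.
      - by left; rewrite p5E !det2E oppr0 mulr0 add0r mulrN opprK mulr_gt0.
      - left; rewrite p6E /w !det2E oppr0 addr0 !mulrN opprD !opprK -mulrDl.
        by rewrite mulr_gt0 // addr_gt0.
      - by left; rewrite p7E /w !det2E oppr0 mulr0 !addr0 mulrN opprK mulr_gt0.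
    * case=> [|[|[|[|[|[|//]]]]]] //= _ _.
      - by rewrite p2E !det2E mulr0 add0r mulr_gt0.
      - rewrite p2E p3E /w (_ : det2 _ _ = (a2 * (a3 + b3) + b2 * b3) * det2 u v).
          by rewrite mulr_gt0 // addr_gt0 ?mulr_gt0 ?addr_gt0.
        by rewrite !det2E (det2C v u); ring.
      - rewrite p3E p4E /w (_ : det2 _ _ =
          (a3 * a4 + a3 * b4 + b3 * b4) * det2 u v).
          by rewrite mulr_gt0 // !addr_gt0 ?mulr_gt0.
        by rewrite !det2E (det2C v u); ring.
      - rewrite p5E p6E /w (_ : det2 _ _ = (a5 * (a6 + b6) + b5 * b6) * det2 u v).
          by rewrite mulr_gt0 // addr_gt0 ?mulr_gt0 ?addr_gt0.
        by rewrite !det2E (det2C v u); ring.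
      - rewrite p6E p7E /w (_ : det2 _ _ =
          (a6 * a7 + a6 * b7 + b6 * b7) * det2 u v).
          by rewrite mulr_gt0 // !addr_gt0 ?mulr_gt0.
        by rewrite !det2E (det2C v u); ring.
  + by case=> [[|[|[|[|[|[|[|//]]]]]]] ?] //=.
  + have p_in k (k7 : (k < 7)%N) : range (fun i : 'I_7 => l`_i) l`_k by exists (Ordinal k7).
    (* The weights [b5] and [a4] cancel [v] between [p4] and [p5], leaving a negative multiple of
       [u]. *)
    have c0 : 0 < b5 * (a4 + b4) + a4 * a5 by rewrite addr_gt0 ?mulr_gt0 ?addr_gt0.
    have E : b5 *: p4 + a4 *: p5 + (b5 * (a4 + b4) + a4 * a5) *: u = 0.
      by rewrite p4E p5E /w; vec.
    exact: (convex_hull_comb3 (p_in 3%N isT) (p_in 4%N isT) (p_in 0%N isT)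
      b5_0 a4_0 c0 E).
- case=> [[|[|[|[|[|[|[|//]]]]]]] ?] //=.
  by rewrite (normB nN).
Qed.

End SmallFamilies.

(** * The norm of the difference body *)

Section Gauge.
Variable R : realType.
Notation V := 'rV[R]_2.

(** The Minkowski functional of [D]. *)
Definition gauge (D : set V) (x : V) : R :=
  inf [set r : R | 0 < r /\ D (r^-1 *: x)].

Variable D : set V.
Hypothesis D_convex : @convex_set R V D.
Hypothesis DN : forall x, D x -> D (- x).
Hypothesis D_closed : closed D.
Hypothesis D_bounded : exists2 K : R, 0 < K & forall x, D x -> `|x| <= K.
Hypothesis D_nbhs0 : exists2 e : R, 0 < e & forall x, `|x| < e -> D x.

Let S x := [set r : R | 0 < r /\ D (r^-1 *: x)].

Let S_neq0 x : S x !=set0.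
Proof.
have [e e0 De] := D_nbhs0.
have x0 := normr_ge0 x.
pose r := (`|x| + 1) / e.
have r0 : 0 < r by rewrite divr_gt0 // ltr_wpDl.
exists r; split => //; apply: De.
rewrite normrZ gtr0_norm ?invr_gt0 // mulrC ltr_pdivrMr // /r mulrC divfK ?gt_eqF //.
by rewrite ltrDl.
Qed.

Let S_lb x : has_lbound (S x).
Proof. by exists 0 => r [/ltW]. Qed.

Let gauge_le x r : 0 < r -> D (r^-1 *: x) -> gauge D x <= r.
Proof. by move=> r0 Dx; apply: ge_inf; [exact: S_lb|split]. Qed.

Let D0 : D 0.
Proof. by have [e e0 De] := D_nbhs0; apply: De; rewrite normr0. Qed.

Let DZ a x : 0 <= a -> a <= 1 -> D x -> D (a *: x).
Proof.
move=> a0 a1 Dx; have cD := (convex_setE D).1 D_convex.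
have := cD x 0 a (1 - a) Dx D0 a0; rewrite scaler0 addr0.
by apply; lra.
Qed.

Let gauge_lt x r : gauge D x < r -> 0 < r /\ D (r^-1 *: x).
Proof.
move=> /(inf_lt (S_neq0 x)) [s [s0 Ds] sr].
have r0 : 0 < r by lra.
split=> //; rewrite (_ : r^-1 *: x = (s / r) *: (s^-1 *: x)).
  apply: DZ => //; first by rewrite divr_ge0 // ltW.
  by rewrite ler_pdivrMr // mul1r ltW.
by rewrite scalerA; congr (_ *: _); field; rewrite !gt_eqF.
Qed.

Let gauge_ge0 x : 0 <= gauge D x.
Proof. by apply: lb_le_inf; [exact: S_neq0|move=> r [/ltW]]. Qed.

Let gaugeD x y : gauge D (x + y) <= gauge D x + gauge D y.
Proof.
apply/ler_addgt0Pr => e e0.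
have e2 : 0 < e / 2 by lra.
have [|r0 Dx] := @gauge_lt x (gauge D x + e / 2); first by lra.
have [|s0 Dy] := @gauge_lt y (gauge D y + e / 2); first by lra.
set r := _ + _ in r0 Dx; set s := _ + _ in s0 Dy.
have -> : gauge D x + gauge D y + e = r + s by rewrite /r /s; field.
have rs0 : 0 < r + s by lra.
apply: gauge_le => //.
have cD := (convex_setE D).1 D_convex.
rewrite (_ : _ *: _ = (r / (r + s)) *: (r^-1 *: x) + (s / (r + s)) *: (s^-1 *: y)).
  apply: cD => //; rewrite ?divr_ge0 ?(ltW r0) ?(ltW s0) ?(ltW rs0) //.
  by rewrite -mulrDl divff // gt_eqF.
by rewrite !scalerA; apply/rowP => i; rewrite !mxE; field; rewrite !gt_eqF.
Qed.

Let gaugeZ_le a x : a != 0 -> gauge D (a *: x) <= `|a| * gauge D x.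
Proof.
move=> a0; have Na : 0 < `|a| by rewrite normr_gt0.
apply/ler_addgt0Pr => e e0.
have ea : 0 < e / `|a| by rewrite divr_gt0.
have [|r0 Dx] := @gauge_lt x (gauge D x + e / `|a|); first by lra.
have -> : `|a| * gauge D x + e = `|a| * (gauge D x + e / `|a|).
  by field; rewrite gt_eqF.
apply: gauge_le; first exact: mulr_gt0.
set r := _ + _ in r0 Dx *.
have [a_gt0|a_lt0|/eqP] := ltgtP a 0; last by rewrite (negPf a0).
- rewrite (ltr0_norm a_gt0) (_ : _ *: _ = - (r^-1 *: x)); first exact: DN.
  by rewrite scalerA -scaleNr; congr (_ *: _); field; rewrite a0 gt_eqF.
- rewrite (gtr0_norm a_lt0) (_ : _ *: _ = r^-1 *: x) //.
  by rewrite scalerA; congr (_ *: _); field; rewrite a0 gt_eqF.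
Qed.

Lemma gauge_norm : is_norm (gauge D).
Proof.
have gauge0 : gauge D 0 = 0.
  apply/eqP; rewrite eq_le gauge_ge0 andbT; apply/ler_addgt0Pr => e e0.
  by rewrite add0r; apply: gauge_le; rewrite ?scaler0.
split=> [||x gx]; first exact: gaugeD.
- move=> a x; have [->|a0] := eqVneq a 0; first by rewrite scale0r gauge0 normr0 mul0r.
  apply/eqP; rewrite eq_le gaugeZ_le //=.
  have Na : 0 < `|a| by rewrite normr_gt0.
  have := @gaugeZ_le a^-1 (a *: x); rewrite invr_eq0 scalerA mulVf // scale1r.
  by move=> /(_ a0); rewrite normfV mulrC ler_pdivlMr // mulrC.
- have [K K0 DK] := D_bounded.
  apply/eqP; rewrite -normr_le0; apply/ler_addgt0Pr => e e0; rewrite add0r.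
  have eK : 0 < e / K by rewrite divr_gt0.
  have [|_ /DK] := @gauge_lt x (e / K); first by rewrite gx.
  rewrite normrZ gtr0_norm ?invr_gt0 // invf_div mulrAC ler_pdivrMr //.
  by rewrite ler_pM2l.
Qed.

Lemma gauge_le1 x : gauge D x <= 1 <-> D x.
Proof.
split=> [gx|Dx]; last by apply: gauge_le; rewrite ?invr1 ?scale1r.
apply: contrapT => nDx.
have : open (~` D) by rewrite openC.
rewrite openE => /(_ x nDx) /nbhs_ballP [e /= e0 He].
(* Chosen so that [x / (1 + d)], which belongs to [D], is within [e] of [x], inside the open
   complement of [D]. *)
pose d := e / (`|x| + 1).
have x1 : 0 < `|x| + 1 by rewrite ltr_wpDl.
have d0 : 0 < d by rewrite divr_gt0.
have xd : d * (`|x| + 1) = e by rewrite divfK // gt_eqF.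
clearbody d.
have [|r0 Dr] := @gauge_lt x (1 + d); first by lra.
apply: (He ((1 + d)^-1 *: x)) => //; rewrite -ball_normE /=.
have -> : x - (1 + d)^-1 *: x = (d / (1 + d)) *: x.
  by apply/rowP => i; rewrite !mxE; field; rewrite gt_eqF.
rewrite normrZ ger0_norm ?divr_ge0 ?(ltW d0) ?(ltW r0) //.
have dd : d / (1 + d) <= d by rewrite ler_pdivrMr //; nra.
have := normr_ge0 x.
by nra.
Qed.

Lemma gauge_lt1 x (d : R) : 0 < d -> D ((1 + d) *: x) -> gauge D x < 1.
Proof.
move=> d0 Dx; have d1 : 0 < 1 + d by lra.
have : gauge D x <= (1 + d)^-1 by apply: gauge_le; rewrite ?invr_gt0 ?invrK.
move=> /le_lt_trans; apply; rewrite invf_lt1 //; lra.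
Qed.

End Gauge.

Section DifferenceBody.
Variable R : realType.
Notation V := 'rV[R]_2.
Variable C : set V.

Definition difference_body : set V := [set z | exists c c', [/\ C c, C c' & z = c - c']].

Lemma in_translate x z : translate C x z <-> C (z - x).
Proof.
split=> [[c Cc <-]|Cz]; first by rewrite addrK.
by exists (z - x); rewrite ?subrK.
Qed.

Lemma translate_meet x y :
  translate C x `&` translate C y !=set0 <-> difference_body (x - y).
Proof.
split=> [[z [/in_translate zx /in_translate zy]]|[c [c' [Cc Cc' E]]]].
  by exists (z - y), (z - x); split => //; vec.
exists (c' + x); split; apply/in_translate; first by rewrite addrK.
by rewrite (_ : _ - _ = c) // -addrA E; vec.
Qed.

Hypothesis hC : convex_disc C.

Let C_convex := let: And3 _ cC _ := hC in (convex_setE C).1 cC.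

Let C_interior : exists (c : V) (e : R), 0 < e /\ forall v, `|v| < e -> C (c + v).
Proof.
have [_ _ [c /nbhs_ballP[e /= e0 He]]] := hC.
exists c, e; split=> // v ve; apply: He; rewrite -ball_normE /=.
by rewrite opprD addrA subrr sub0r normrN.
Qed.

(** Contraction by the factor [a] towards the centre of a ball of radius [e] in [C] leaves a margin
    [(1 - a) e]; the same displacement [w] serves both points. *)
Let C_shrink : exists2 e : R, 0 < e & forall (c c' : V) (a : R), C c -> C c' ->
  0 <= a -> a < 1 -> exists w : V, forall v, `|v| < (1 - a) * e ->
    C (w + a *: c + v) /\ C (w + a *: c' + v).
Proof.
have [c0 [e [e0 He]]] := C_interior.
exists e => // c c' a Cc Cc' a0 a1; exists ((1 - a) *: c0) => v ve.
have a1' : 0 < 1 - a by lra.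
have Cv : C (c0 + (1 - a)^-1 *: v).
  apply: He; rewrite normrZ gtr0_norm ?invr_gt0 //.
  by rewrite mulrC ltr_pdivrMr // mulrC.
have E d : (1 - a) *: c0 + a *: d + v = a *: d + (1 - a) *: (c0 + (1 - a)^-1 *: v).
  by apply/rowP => i; rewrite !mxE; field; rewrite gt_eqF.
by split; rewrite E; apply: C_convex => //; lra.
Qed.

Let D_convex : @convex_set R V difference_body.
Proof.
apply/convex_setE => x y a b [c [c' [Cc Cc' ->]]] [d [d' [Cd Cd' ->]]] a0 b0 ab.
exists (a *: c + b *: d), (a *: c' + b *: d'); split; last by vec.
- exact: C_convex.
- exact: C_convex.
Qed.

Let DN x : difference_body x -> difference_body (- x).
Proof. by move=> [c [c' [Cc Cc' ->]]]; exists c', c; rewrite opprB. Qed.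

Let D_closed : closed difference_body.
Proof.
have [cptC _ _] := hC.
apply: compact_closed; first exact: norm_hausdorff.
have -> : difference_body = (fun p : V * V => p.1 - p.2) @` (C `*` C).
  apply/seteqP; split=> [z [c [c' [Cc Cc' ->]]]|_ [[c c'] [/= Cc Cc'] <-]].
    by exists (c, c').
  by exists c, c'.
apply: continuous_compact; last exact: compact_setX.
apply: continuous_subspaceT => p.
by apply: cvgB; [exact: cvg_fst|exact: cvg_snd].
Qed.

Let D_bounded : exists2 K : R, 0 < K & forall x, difference_body x -> `|x| <= K.
Proof.
have [cptC _ _] := hC.
have /ex_strict_bound_gt0 [K K0 CK] := compact_bounded cptC.
exists (K + K); first by rewrite addr_gt0.
move=> _ [c [c' [Cc Cc' ->]]]; apply: (le_trans (ler_normB _ _)).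
by apply: lerD; apply: ltW; exact: CK.
Qed.

Let D_nbhs0 : exists2 e : R, 0 < e & forall x, `|x| < e -> difference_body x.
Proof.
have [c0 [e [e0 He]]] := C_interior.
exists e => // x xe; exists (c0 + x), (c0 + 0); split; last by vec.
- exact: He.
- by apply: He; rewrite normr0.
Qed.

Let N := gauge difference_body.

Lemma difference_norm : is_norm N.
Proof. exact: gauge_norm D_convex DN D_bounded D_nbhs0. Qed.

Lemma difference_norm_le1 x : N x <= 1 <-> difference_body x.
Proof. exact: gauge_le1 D_convex D_closed D_nbhs0 x. Qed.

(** A common interior point can be moved along [x - y] within one translate, so a larger multiple of
    [x - y] is a difference of points of [C]. Conversely, norm less than 1 leaves room to contract
    [C] and gain a margin. *)
Lemma overlap_translate x y :
  overlap (translate C x) (translate C y) <-> N (x - y) < 1.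
Proof.
split=> [[w [wx wy]]|Nxy].
  have /interior_subset/in_translate Cwx := wx.
  have [e /= e0 He] := (nbhs_ballP _ _).1 wy.
  set z := x - y; pose d := e / (2 * (`|z| + 1)).
  have z1 : 0 < `|z| + 1 by rewrite ltr_wpDl.
  have d0 : 0 < d by rewrite divr_gt0 // mulr_gt0.
  apply: (gauge_lt1 d0).
  have : translate C y (w + d *: z).
    apply: He; rewrite -ball_normE /= opprD addrA subrr sub0r normrN normrZ gtr0_norm //.
    have : d * (`|z| + 1) = e / 2 by rewrite /d; field; rewrite gt_eqF.
    by nra.
  move=> /in_translate Cwy; exists (w + d *: z - y), (w - x); split=> //.
  by rewrite /z; vec.
have N0 := norm_ge0 difference_norm (x - y).
pose a := (N (x - y) + 1) / 2.
have a0 : 0 < a by rewrite /a; lra.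
have a1 : a < 1 by rewrite /a; lra.
have : N (a^-1 *: (x - y)) <= 1.
  rewrite (normZ difference_norm) gtr0_norm ?invr_gt0 // mulrC ler_pdivrMr //.
  by rewrite mul1r /a; lra.
move=> /difference_norm_le1 [c [c' [Cc Cc' E]]].
have xy : x - y = a *: (c - c') by rewrite -E scalerA divff ?gt_eqF // scale1r.
have [e e0 He] := C_shrink.
have [w Hw] := He c c' a Cc Cc' (ltW a0) a1.
have ae : 0 < (1 - a) * e by rewrite mulr_gt0 // subr_gt0.
(* As [x - y = a (c - c')], this point is also [w + a c + y], so it is interior to both
   translates. *)
exists (w + a *: c' + x); split; apply/nbhs_ballP; exists ((1 - a) * e) => // z;
  rewrite -ball_normE /= distrC => /Hw [H1 H2]; apply/in_translate.
- by move: H2; rewrite (_ : _ + _ = z - x) //; vec.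
- move: H1; rewrite (_ : _ + _ = z - y) //.
  have -> : x = a *: (c - c') + y by rewrite -xy subrK.
  by vec.
Qed.

Lemma translate0 : translate C 0 = C.
Proof. by apply/seteqP; split=> z /=; rewrite in_translate subr0. Qed.

Lemma touch_translate x : touch (translate C x) C <-> N x = 1.
Proof.
rewrite -{2}translate0 /touch translate_meet overlap_translate !subr0.
rewrite -difference_norm_le1; split=> [[N1 /negP]|->].
  by rewrite -leNgt => N1'; apply/eqP; rewrite eq_le N1.
by split=> //; rewrite ltxx.
Qed.

Lemma dual_hadwiger_familyE n (x : 'I_n -> V) : dual_hadwiger_family C x <->
  unit_family N x /\ forall i, N (x i - x (ordS i)) <= 1.
Proof.
split=> [[cx tx mx hx]|[[cx x1 hx] xd]]; split=> //.
- by split=> // i; apply/touch_translate.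
- by move=> i; apply/difference_norm_le1/translate_meet.
- by move=> i; apply/touch_translate.
- by move=> i; apply/translate_meet/difference_norm_le1.
Qed.

Lemma dual_strict_hadwiger_familyE n (x : 'I_n -> V) :
  dual_strict_hadwiger_family C x <->
  unit_family N x /\ forall i, N (x i - x (ordS i)) < 1.
Proof.
split=> [[cx tx mx hx]|[[cx x1 hx] xd]]; split=> //.
- by split=> // i; apply/touch_translate.
- by move=> i; apply/overlap_translate.
- by move=> i; apply/touch_translate.
- by move=> i; apply/overlap_translate.
Qed.

End DifferenceBody.

(** * Parallelograms and their difference bodies *)

Section Parallelograms.
Variable R : realType.
Notation V := 'rV[R]_2.

Lemma row_free_det2 (u v : V) : row_free (col_mx u v) <-> det2 u v != 0.
Proof.
split=> [uv|uv].
- apply/eqP => d0.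
  have H (a b : R) : a *: u + b *: v = 0 -> a = 0 /\ b = 0.
    move=> E; have : row_mx a%:M b%:M *m col_mx u v = 0.
      by rewrite mul_row_col !mul_scalar_mx.
    rewrite -[RHS](mul0mx _ (col_mx u v)) => /(row_free_inj uv).
    rewrite -row_mx0 => /eq_row_mx [Ea Eb].
    have := congr1 (fun M : 'M[R]_1 => M 0 0) Ea.
    have := congr1 (fun M : 'M[R]_1 => M 0 0) Eb.
    by rewrite !mxE /= !mulr1n.
  (* A zero determinant makes the columns of coordinates into vanishing combinations of [u] and [v].
     Independence kills all coordinates, and then [1 u + 0 v = 0] is a contradiction. *)
  have [v0 /eqP] : v 0 0 = 0 /\ - u 0 0 = 0.
    by apply: H; apply: rV2P; rewrite !mxE; move: d0; rewrite /det2; lra.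
  rewrite oppr_eq0 => /eqP u0.
  have [v1 /eqP] : v 0 1 = 0 /\ - u 0 1 = 0.
    by apply: H; apply: rV2P; rewrite !mxE; move: d0; rewrite /det2; lra.
  rewrite oppr_eq0 => /eqP u1.
  have [] : (1 : R) = 0 /\ (0 : R) = 0.
    by apply: H; apply: rV2P; rewrite !mxE ?u0 ?u1 ?v0 ?v1; ring.
  by move=> /eqP; rewrite oner_eq0.
- rewrite -kermx_eq0; apply/rowV0P => w /sub_kermxP.
  rewrite -[w]hsubmxK mul_row_col.
  set a := lsubmx w; set b := rsubmx w.
  rewrite [a]mx11_scalar [b]mx11_scalar !mul_scalar_mx => E.
  have Eu := congr1 (fun z => det2 z v) E; have Ev := congr1 (fun z => det2 u z) E.
  rewrite /= !det2E mulr0 addr0 in Eu; rewrite /= !det2E mulr0 add0r in Ev.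
  have -> : a 0 0 = 0.
    by apply: (mulIf uv); rewrite Eu mul0r /det2 !mxE; ring.
  have -> : b 0 0 = 0.
    by apply: (mulIf uv); rewrite Ev mul0r /det2 !mxE; ring.
  have -> : (0 : R)%:M = 0 :> 'M[R]_1 by apply/matrixP => i j; rewrite !mxE mul0rn.
  by rewrite row_mx0.
Qed.

Lemma comb_inj (u v : V) (a b a' b' : R) : det2 u v != 0 ->
  a *: u + b *: v = a' *: u + b' *: v -> a = a' /\ b = b'.
Proof.
move=> uv E; have Eu := congr1 (fun z => det2 z v) E.
have Ev := congr1 (fun z => det2 u z) E.
rewrite /= !det2E !mulr0 !addr0 in Eu; rewrite /= !det2E !mulr0 !add0r in Ev.
by split; apply: (mulIf uv).
Qed.

Variable C : set V.

Lemma parallelogram_difference (hC : convex_disc C) : parallelogram C ->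
  exists d m, 0 < det2 d m /\ parallelogram_norm (gauge (difference_body C)) d m.
Proof.
have P (a u v : V) : 0 < det2 u v ->
    C = [set a + s *: u + t *: v | s in `[0, 1] & t in `[0, 1]] ->
    parallelogram_norm (gauge (difference_body C)) u v.
  move=> uv CE x y; apply/idP/andP => [/(difference_norm_le1 hC)|[]].
  - rewrite CE => -[_ [_ [[s /= s01 [t /= t01 <-]] [s' /= s01' [t' /= t01' <-]]]]].
    move: s01 s01' t01 t01'; rewrite !in_itv /=.
    move=> /andP[? ?] /andP[? ?] /andP[? ?] /andP[? ?] E.
    have [-> ->] : x = s - s' /\ y = t - t'.
      by apply: comb_inj (lt0r_neq0 uv) _; rewrite E; vec.
    by rewrite !ler_norml; split; apply/andP; split; lra.
  - rewrite !ler_norml => /andP[? ?] /andP[? ?].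
    apply/(difference_norm_le1 hC).
    (* The coefficients [(1 + x) / 2] and [(1 - x) / 2] lie in the unit interval and differ by [x];
       likewise for [y]. *)
    exists (a + ((1 + x) / 2) *: u + ((1 + y) / 2) *: v),
           (a + ((1 - x) / 2) *: u + ((1 - y) / 2) *: v).
    split; last by apply/rowP => i; rewrite !mxE; field.
    + rewrite CE; exists ((1 + x) / 2); first by rewrite /= in_itv /=; apply/andP; split; lra.
      by exists ((1 + y) / 2); first by rewrite /= in_itv /=; apply/andP; split; lra.
    + rewrite CE; exists ((1 - x) / 2); first by rewrite /= in_itv /=; apply/andP; split; lra.
      by exists ((1 - y) / 2); first by rewrite /= in_itv /=; apply/andP; split; lra.
move=> [a [u [v [/row_free_det2 uv CE]]]].
have [uv0|uv0|/eqP] := ltgtP (det2 u v) 0; last by rewrite (negPf uv).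
- exists v, u; split; first by rewrite det2C oppr_gt0.
  apply: (P a); first by rewrite det2C oppr_gt0.
  rewrite CE; apply/seteqP; split=> [_ [s s01 [t t01 <-]]|_ [s s01 [t t01 <-]]].
  + by exists t => //; exists s => //; vec.
  + by exists t => //; exists s => //; vec.
- by exists u, v; split=> //; exact: (P a).
Qed.

(* Differences of [C] realise both diagonals [d + m] and [d - m], and this forces
   the four corners of a translate of the unit parallelogram into [C]. *)
Lemma difference_parallelogram (hC : convex_disc C) d m : 0 < det2 d m ->
  parallelogram_norm (gauge (difference_body C)) d m -> parallelogram C.
Proof.
move=> dm pN; have dm0 := lt0r_neq0 dm.
have [_ /convex_setE cC _] := hC.
have in_D (x y : R) : `|x| <= 1 -> `|y| <= 1 -> difference_body C (x *: d + y *: m).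
  by move=> x1 y1; apply/(difference_norm_le1 hC); rewrite pN x1.
have n1 : `|1 : R| <= 1 by rewrite normr1.
have nN1 : `|-1 : R| <= 1 by rewrite normrN normr1.
have [p [q [Cp Cq pq]]] := in_D 1 1 n1 n1.
have [r [s [Cr Cs rs]]] := in_D 1 (-1) n1 nN1.
pose xi z := det2 z m / det2 d m; pose eta z := det2 d z / det2 d m.
have coordE z : z = xi z *: d + eta z *: m by exact: cramer.
have coordB z z' : z - z' = (xi z - xi z') *: d + (eta z - eta z') *: m.
  by rewrite {1}[z]coordE {1}[z']coordE; vec.
have D_le c c' : C c -> C c' -> xi c - xi c' <= 1 /\ eta c - eta c' <= 1.
  move=> Cc Cc'.
  have : gauge (difference_body C) (c - c') <= 1.
    by apply/(difference_norm_le1 hC); exists c, c'.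
  by rewrite coordB pN !ler_norml => /andP[/andP[_ ->] /andP[_ ->]].
have coord_eq z z' (a b : R) : a *: d + b *: m = z - z' ->
    xi z - xi z' = a /\ eta z - eta z' = b.
  by move=> E; apply: (comb_inj dm0); rewrite -coordB.
have [xpq epq] := coord_eq _ _ _ _ pq.
have [xrs ers] := coord_eq _ _ _ _ rs.
(* No coordinate varies by more than 1 over [C], and [p - q] attains 1 in both, so [q] and [p] are
   the extreme corners of a box containing [C]. The points [r] and [s] differ by its full width and
   height and must be the other two corners. *)
have box c : C c -> [/\ xi q <= xi c, xi c <= xi q + 1, eta q <= eta c & eta c <= eta q + 1].
  move=> Cc; have [? ?] := D_le _ _ Cc Cq; have [? ?] := D_le _ _ Cp Cc.
  by split; lra.
have [? ? ? ?] := box _ Cr; have [? ? ? ?] := box _ Cs.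
have shift z (a b : R) : xi z = xi q + a -> eta z = eta q + b ->
    z = q + a *: d + b *: m.
  move=> xz ez; rewrite -[LHS](subrK q) coordB xz ez; vec.
have pE : p = q + d + m by rewrite [LHS](shift p 1 1) ?scale1r //; lra.
have rE : r = q + d by rewrite [LHS](shift r 1 0) ?scale1r ?scale0r ?addr0 //; lra.
have sE : s = q + m by rewrite [LHS](shift s 0 1) ?scale1r ?scale0r ?addr0 //; lra.
exists q, d, m; split; first exact/row_free_det2.
apply/seteqP; split=> [c Cc|_ [a /= a01 [b /= b01 <-]]].
- have [? ? ? ?] := box c Cc.
  exists (xi c - xi q); first by rewrite /= in_itv /=; apply/andP; split; lra.
  exists (eta c - eta q); first by rewrite /= in_itv /=; apply/andP; split; lra.
  by rewrite -[RHS](subrK q) coordB; vec.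
- move: a01 b01; rewrite !in_itv /= => /andP[a0 a1] /andP[b0 b1].
  have a1' : 0 <= 1 - a by lra.
  have b1' : 0 <= 1 - b by lra.
  have Cbot := cC _ _ _ _ Cr Cq a0 a1' (subrKC _ _).
  have Ctop := cC _ _ _ _ Cp Cs a0 a1' (subrKC _ _).
  have := cC _ _ _ _ Ctop Cbot b0 b1' (subrKC _ _).
  rewrite pE rE sE; congr (C _); vec.
Qed.

End Parallelograms.

(** * The dual Hadwiger numbers *)

Lemma min_nat_eq (S : set nat) k : S k -> (forall j, S j -> (k <= j)%N) ->
  min_nat S = k.
Proof.
move=> Sk kS; apply: xget_unique.
  by split=> // j Sj; rewrite leEnat; exact: kS.
move=> j [Sj jS]; apply/eqP; rewrite eqn_leq kS // andbT.
by have := jS _ Sk; rewrite leEnat.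
Qed.

Theorem proposition24 (R : realType) (C : set 'rV[R]_2) (hC : convex_disc C) :
  [/\ ~ parallelogram C -> dual_hadwiger_number C = 6%N,
      parallelogram C -> dual_hadwiger_number C = 4%N,
      ~ parallelogram C -> dual_strict_hadwiger_number C = 7%N
    & parallelogram C -> dual_strict_hadwiger_number C = 8%N].
Proof.
have nN := difference_norm hC.
have good : ~ parallelogram C ->
    exists u v, good_hexagon (gauge (difference_body C)) u v.
  move=> nP; have [[d [m [dm pN]]]|//] := parallelogram_or_good_hexagon nN.
  by case: nP; exact: difference_parallelogram hC _ _ dm pN.
split=> [/good[u [v uv]]|P|/good[u [v uv]]|P]; apply: min_nat_eq.
- have [u1 v1 vu1 duv _] := uv.
  have [x fx xd] := family_of_6 nN u1 v1 vu1 duv.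
  by exists x; apply/(dual_hadwiger_familyE hC).
- move=> n [x /(dual_hadwiger_familyE hC) [fx xd]].
  exact: (family_ge6 nN uv fx xd).
- have [d [m [dm pN]]] := parallelogram_difference hC P.
  have [x fx xd] := family_of_4 nN dm pN.
  by exists x; apply/(dual_hadwiger_familyE hC).
- move=> n [x /(dual_hadwiger_familyE hC) [fx xd]].
  exact: (family_ge4 nN fx xd).
- have [x fx xd] := strict_family_of_7 nN uv.
  by exists x; apply/(dual_strict_hadwiger_familyE hC).
- move=> n [x /(dual_strict_hadwiger_familyE hC) [fx xd]].
  exact: (strict_family_ge7 nN fx xd).
- have [d [m [dm pN]]] := parallelogram_difference hC P.
  have [x fx xd] := strict_family_of_8 nN dm pN.
  by exists x; apply/(dual_strict_hadwiger_familyE hC).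
- have [d [m [dm pN]]] := parallelogram_difference hC P.
  move=> n [x /(dual_strict_hadwiger_familyE hC) [fx xd]].
  exact: (strict_family_ge8 nN dm pN fx xd).
Qed.
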